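(* Let $n\ge2$, let $z_1,\dots,z_n,m_1,\dots,m_n\in\mathbb C$ and let $l$ be a nonnegative integer. Assume that the pair $\bigl((m_1,0),\dots,(m_n,0)\bigr),\,l$ is separating, i.e. $\sum_{i=1}^nm_i-2l+1+s\ne0$ for all $s=1,\dots,l$. Then the map $\tau:A_D^*\to\mathrm{Sing}\,W_{a,d}[l]$, $g\mapsto(\mathrm{id}\otimes g)(\omega_D)$, identifies the action of the operators $L_f^*$, $f\in A_D$, on $A_D^*$ with the action of the Bethe algebra on $\mathrm{Sing}\,W_{a,d}[l]$: $\tau$ is a linear isomorphism and $\tau(L_f^*(g))=\psi_{DW}(f)(\tau(g))$ for all $f\in A_D$, $g\in A_D^*$. Hence the algebra epimorphism $\psi_{DW}:A_D\to A_W$ is an isomorphism.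
   Context: Put $a(u)=\prod_{i=1}^n(u-z_i+m_i)$ and $d(u)=\prod_{i=1}^n(u-z_i)$. Yangian: $Y(\mathfrak{gl}_2)$ is the unital associative complex algebra with generators $T_{ab}^{\{s\}}$, $a,b\in\{1,2\}$, $s\ge1$; with $T_{ab}(u)=\delta_{ab}+\sum_{s\ge1}T_{ab}^{\{s\}}u^{-s}$ its relations are $(u-v)\bigl(T_{ab}(u)T_{cd}(v)-T_{cd}(v)T_{ab}(u)\bigr)=T_{cb}(v)T_{ad}(u)-T_{cb}(u)T_{ad}(v)$. $U(\mathfrak{gl}_2)$ is embedded by $e_{ab}\mapsto T_{ba}^{\{1\}}$. The holomorphic representation $W_{a,d}$ is the vector space $\mathbb C[x_1,\dots,x_n]$ with the unique $Y(\mathfrak{gl}_2)$-action such that $T_{12}(u)\cdot p=\frac1{d(u)}\sum_{i=1}^nu^{n-i}x_i\,p$ for every polynomial $p$, and $T_{11}(u)\cdot1=\frac{a(u)}{d(u)}$, $T_{22}(u)\cdot1=1$, $T_{21}(u)\cdot1=0$. $W_{a,d}[l]$ is the subspace of homogeneous polynomials of degree $l$, and $\mathrm{Sing}\,W_{a,d}[l]=\{p\in W_{a,d}[l]\mid e_{12}p=0\}$. On $W_{a,d}$ one has $T_{11}(u)+T_{22}(u)=\frac1{d(u)}\sum_{k=0}^n\tilde H_ku^{n-k}$ with commuting operators $\tilde H_k$, $\tilde H_0=2$, preserving $\mathrm{Sing}\,W_{a,d}[l]$; $H_k=\tilde H_k|_{\mathrm{Sing}\,W_{a,d}[l]}$.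 The Bethe algebra $A_W$ is the unital subalgebra of $\mathrm{End}(\mathrm{Sing}\,W_{a,d}[l])$ generated by $H_1,\dots,H_n$. Algebra $A_D$: let $\boldsymbol a=(a_1,\dots,a_l)$, $\boldsymbol h=(h_1,\dots,h_n)$ be variables, $p(u,\boldsymbol a)=u^l+a_1u^{l-1}+\dots+a_l$, $B(u,\boldsymbol h)=2u^n+h_1u^{n-1}+\dots+h_n$. Set $q_1=h_1-\sum_{i=1}^n(m_i-2z_i)$, $q_2=h_2-l\bigl(l-1-\sum_{i=1}^nm_i\bigr)-\sum_{1\le i<j\le n}\bigl(z_iz_j+(z_i-m_i)(z_j-m_j)\bigr)$, and for $3\le i\le l+n$ let $q_i(\boldsymbol a,\boldsymbol h)$ be the coefficient of $u^{l+n-i}$ in $d(u)p(u,\boldsymbol a)-B(u,\boldsymbol h)p(u-1,\boldsymbol a)+a(u)p(u-2,\boldsymbol a)$ (when $q_1=q_2=0$ this polynomial has degree at most $l+n-3$ in $u$). Then $A_D=\mathbb C[\boldsymbol a,\boldsymbol h]/I_D$ with $I_D=(q_1,\dots,q_{l+n})$; it is finite-dimensional in the separating case. For $f\in A_D$, $L_f:A_D\to A_D$ is multiplication by $f$ and $L_f^*:A_D^*\to A_D^*$ is the dual operator. In the separating case $A_D$ is generated by the classes of $h_1,\dots,h_n$, and $\psi_{DW}:A_D\to A_W$ is the algebra epimorphism with $h_s\mapsto H_s$, $s=1,\dots,n$. Universal weight function: introduce $y_0,\dots,y_{n-1}$ by $\sum_{i=1}^nx_iu^{n-i}=y_0\prod_{j=1}^{n-1}(u-y_j)$.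 This identifies $W_{a,d}[l]$ with $y_0^l$ times the space of symmetric polynomials in $y_1,\dots,y_{n-1}$ of degree at most $l$ in each variable. Under this identification $\omega(\boldsymbol y,\boldsymbol a)=y_0^l\prod_{j=1}^{n-1}p(y_j-1,\boldsymbol a)$ is an element of $W_{a,d}[l]\otimes\mathbb C[\boldsymbol a]$, and $\omega_D$ denotes its image in $W_{a,d}[l]\otimes A_D$. In the separating case $\omega_D\in\mathrm{Sing}\,W_{a,d}[l]\otimes A_D$, so $\tau$ is well defined. *)

(* Defs.v *)
From HB Require Import structures.
From mathcomp Require Import all_boot all_order all_algebra.
From mathcomp Require Import perm ring_quotient.
From mathcomp.classical Require Import boolp.
From mathcomp Require Import reals complex mpoly.

Set Implicit Arguments.
Unset Strict Implicit.
Unset Printing Implicit Defensive.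

Import GRing.Theory Num.Theory.
Local Open Scope ring_scope.

(* {linear U -> V} as a K-module, and {linear V -> V} as a ring under
   composition.  MathComp's own algebra structures require 1 != 0, which is not
   known a priori for the algebras below, so each K-algebra here is a pzRingType
   that is also an lmodType K. *)
Section LinearMaps.
Variables (K : comNzRingType) (U V : lmodType K).
Implicit Types f g h : {linear U -> V}.

HB.instance Definition _ := gen_eqMixin {linear U -> V}.
HB.instance Definition _ := gen_choiceMixin {linear U -> V}.

Lemma lin_ext f g : (forall x, f x = g x) -> f = g.
Proof.
move=> fg; have : (f : U -> V) = g by apply/funext.
case: f fg => f [cf sf] fg; case: g fg => g [cg sg] /= _ efg.
case: _ / efg cg sg => cg sg.
have -> : cf = cg by case: cf cg => p [q]; f_equal; exact: Prop_irrelevance.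
by have -> : sf = sg by case: sf sg => p [q]; f_equal; exact: Prop_irrelevance.
Qed.

Definition lin_zero : {linear U -> V} := \0.
Definition lin_opp f : {linear U -> V} := \- f.
Definition lin_add f g : {linear U -> V} := f \+ g.
Definition lin_scale (c : K) f : {linear U -> V} := c \*: f.

Fact lin_addA : associative lin_add.
Proof. by move=> f g h; apply: lin_ext => x /=; rewrite addrA. Qed.
Fact lin_addC : commutative lin_add.
Proof. by move=> f g; apply: lin_ext => x /=; rewrite addrC. Qed.
Fact lin_add0 : left_id lin_zero lin_add.
Proof. by move=> f; apply: lin_ext => x /=; rewrite add0r. Qed.
Fact lin_addN : left_inverse lin_zero lin_opp lin_add.
Proof. by move=> f; apply: lin_ext => x /=; rewrite addNr. Qed.
HB.instance Definition _ := GRing.isZmodule.Build {linear U -> V}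
  lin_addA lin_addC lin_add0 lin_addN.

Fact lin_scaleA a b f : lin_scale a (lin_scale b f) = lin_scale (a * b) f.
Proof. by apply: lin_ext => x /=; rewrite scalerA. Qed.
Fact lin_scale1 : left_id 1 lin_scale.
Proof. by move=> f; apply: lin_ext => x /=; rewrite scale1r. Qed.
Fact lin_scaleDr : right_distributive lin_scale +%R.
Proof. by move=> a f g; apply: lin_ext => x /=; rewrite scalerDr. Qed.
Fact lin_scaleDl f : {morph lin_scale^~ f : a b / a + b}.
Proof. by move=> a b; apply: lin_ext => x /=; rewrite scalerDl. Qed.
HB.instance Definition _ := GRing.Zmodule_isLmodule.Build K {linear U -> V}
  lin_scaleA lin_scale1 lin_scaleDr lin_scaleDl.

Lemma linDE f g x : (f + g) x = f x + g x. Proof. by []. Qed.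
Lemma linNE f x : (- f) x = - f x. Proof. by []. Qed.
End LinearMaps.

Section Endomorphisms.
Variables (K : comNzRingType) (V : lmodType K).
Implicit Types f g h : {linear V -> V}.

Definition lin_id : {linear V -> V} := idfun.
Definition lin_comp f g : {linear V -> V} := f \o g.

Fact lin_compA : associative lin_comp.
Proof. by move=> f g h; apply: lin_ext. Qed.
Fact lin_comp1l : left_id lin_id lin_comp.
Proof. by move=> f; apply: lin_ext. Qed.
Fact lin_comp1r : right_id lin_id lin_comp.
Proof. by move=> f; apply: lin_ext. Qed.
Fact lin_compDl : left_distributive lin_comp +%R.
Proof. by move=> f g h; apply: lin_ext. Qed.
Fact lin_compDr : right_distributive lin_comp +%R.
Proof. by move=> f g h; apply: lin_ext => x /=; rewrite linearD. Qed.
HB.instance Definition _ := GRing.Zmodule_isPzRing.Build {linear V -> V}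
  lin_compA lin_comp1l lin_comp1r lin_compDl lin_compDr.

Lemma linME f g x : (f * g) x = f (g x). Proof. by []. Qed.
Lemma lin_commZ f a g : f * (a *: g) - (a *: g) * f = a *: (f * g - g * f).
Proof.
apply: lin_ext => x.
change (f (a *: g x) - a *: g (f x) = a *: (f (g x) - g (f x))).
by rewrite linearZ scalerBr.
Qed.

End Endomorphisms.

Local Open Scope quotient_scope.

(* The quotient of a commutative algebra by the ideal (q_0, ..., q_(N-1)), which
   may be the whole algebra. *)
Section IdealQuotient.
Variables (K : comNzRingType) (A : comAlgType K) (N : nat) (q : 'I_N -> A).

Definition ideal_gen : {pred A} :=
  fun f => `[< exists c : 'I_N -> A, f = \sum_i c i * q i >].

Lemma ideal_genP f :
  reflect (exists c : 'I_N -> A, f = \sum_i c i * q i) (f \in ideal_gen).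
Proof. exact: asboolP. Qed.

Fact ideal_gen_zmod : zmod_closed ideal_gen.
Proof.
split=> [|_ _ /ideal_genP[c ->] /ideal_genP[e ->]]; apply/ideal_genP.
  by exists (fun=> 0); rewrite big1 // => i _; rewrite mul0r.
by exists (fun i => c i - e i); rewrite -sumrB; apply: eq_bigr => i _; rewrite mulrBl.
Qed.
HB.instance Definition _ := GRing.isZmodClosed.Build A ideal_gen ideal_gen_zmod.

Lemma ideal_genM a f : f \in ideal_gen -> a * f \in ideal_gen.
Proof.
case/ideal_genP=> c ->; apply/ideal_genP; exists (fun i => a * c i).
by rewrite mulr_sumr; apply: eq_bigr => i _; rewrite mulrA.
Qed.

Definition quot_alg := Quotient.quot ideal_gen.
HB.instance Definition _ := GRing.Zmodule.on quot_alg.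
Definition qpi (f : A) : quot_alg := \pi_(Quotient.quot ideal_gen) f.

Lemma qpi_eq f g : (qpi f == qpi g) = (f - g \in ideal_gen).
Proof. by rewrite Quotient.idealrBE. Qed.

Lemma qpiP (x : quot_alg) : exists f, x = qpi f.
Proof. by exists (repr x); rewrite /qpi reprK. Qed.

Fact qpi_zmod : zmod_morphism qpi.
Proof. by move=> f g; rewrite /qpi !piE. Qed.
HB.instance Definition _ := GRing.isZmodMorphism.Build A quot_alg qpi qpi_zmod.

Definition qmul (x y : quot_alg) : quot_alg := qpi (repr x * repr y).
Definition qscale (a : K) (x : quot_alg) : quot_alg := qpi (a *: repr x).

Lemma repr_qpi f : f - repr (qpi f) \in ideal_gen.
Proof. by rewrite -qpi_eq /qpi reprK. Qed.

Lemma qmulE f g : qmul (qpi f) (qpi g) = qpi (f * g).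
Proof.
apply/eqP; rewrite eq_sym qpi_eq.
have -> : f * g - repr (qpi f) * repr (qpi g)
   = g * (f - repr (qpi f)) + repr (qpi f) * (g - repr (qpi g)).
  by rewrite !mulrBr [g * f]mulrC [g * _]mulrC addrA subrK.
by rewrite rpredD ?ideal_genM ?repr_qpi.
Qed.

Lemma qscaleE a f : qscale a (qpi f) = qpi (a *: f).
Proof.
apply/eqP; rewrite eq_sym qpi_eq -scalerBr -[X in a *: X]mul1r scalerAl.
by rewrite ideal_genM ?repr_qpi.
Qed.

Fact qmulA : associative qmul.
Proof.
by move=> x y z; have [[f ->] [g ->] [h ->]] := And3 (qpiP x) (qpiP y) (qpiP z);
  rewrite !qmulE mulrA.
Qed.
Fact qmulC : commutative qmul.
Proof. by move=> x y; rewrite /qmul mulrC. Qed.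
Fact qmul1 : left_id (qpi 1) qmul.
Proof. by move=> x; have [f ->] := qpiP x; rewrite qmulE mul1r. Qed.
Fact qmulDl : left_distributive qmul +%R.
Proof.
by move=> x y z; have [[f ->] [g ->] [h ->]] := And3 (qpiP x) (qpiP y) (qpiP z);
  rewrite -raddfD !qmulE mulrDl raddfD.
Qed.
HB.instance Definition _ := GRing.Zmodule_isComPzRing.Build quot_alg
  qmulA qmulC qmul1 qmulDl.

Fact qpi_monoid : monoid_morphism qpi.
Proof. by split=> // f g; rewrite -qmulE. Qed.
HB.instance Definition _ := GRing.isMonoidMorphism.Build A quot_alg qpi qpi_monoid.

Fact qscaleA a b x : qscale a (qscale b x) = qscale (a * b) x.
Proof. by have [f ->] := qpiP x; rewrite !qscaleE scalerA. Qed.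
Fact qscale1 : left_id 1 qscale.
Proof. by move=> x; have [f ->] := qpiP x; rewrite qscaleE scale1r. Qed.
Fact qscaleDr : right_distributive qscale +%R.
Proof.
move=> a x y; have [[f ->] [g ->]] := (qpiP x, qpiP y).
by rewrite -raddfD !qscaleE scalerDr raddfD.
Qed.
Fact qscaleDl x : {morph qscale^~ x : a b / a + b}.
Proof.
by move=> a b; have [f ->] := qpiP x; rewrite !qscaleE scalerDl raddfD.
Qed.
HB.instance Definition _ := GRing.Zmodule_isLmodule.Build K quot_alg
  qscaleA qscale1 qscaleDr qscaleDl.

Fact qpi_scalable : scalable qpi.
Proof. by move=> a f; rewrite -qscaleE. Qed.
HB.instance Definition _ := GRing.isScalable.Build K A quot_alg _ qpi qpi_scalable.

Lemma quot_scalerAl (a : K) (x y : quot_alg) : a *: (x * y) = (a *: x) * y.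
Proof.
have [[f ->] [g ->]] := (qpiP x, qpiP y).
by rewrite -rmorphM -!linearZ -rmorphM /= scalerAl.
Qed.

(* L_f and its dual L_f^*; the dual space is {linear quot_alg -> K^o}. *)
Definition qmull (f x : quot_alg) : quot_alg := f * x.
Fact qmull_linear f : linear (qmull f).
Proof.
move=> a x y; rewrite /qmull mulrDr; congr (_ + _).
by rewrite mulrC -quot_scalerAl mulrC. Qed.
HB.instance Definition _ f :=
  GRing.isLinear.Build K quot_alg quot_alg _ (qmull f) (qmull_linear f).

Definition mul_dual (f : quot_alg) (g : {linear quot_alg -> K^o}) :
    {linear quot_alg -> K^o} := g \o qmull f.

End IdealQuotient.

(* The unital subalgebra of End(V) generated by S: the intersection of all unital
   subalgebras containing S. *)
Section GeneratedSubalgebra.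
Variables (K : comNzRingType) (V : lmodType K) (S : {linear V -> V} -> Prop).

Definition subalg_gen : {pred {linear V -> V}} := fun f =>
  `[< forall B : {pred {linear V -> V}}, 1 \in B -> GRing.linear_closed B ->
      GRing.mulr_2closed B -> (forall g, S g -> g \in B) -> f \in B >].

Lemma subalg_genP f : reflect
  (forall B : {pred {linear V -> V}}, 1 \in B -> GRing.linear_closed B ->
      GRing.mulr_2closed B -> (forall g, S g -> g \in B) -> f \in B)
  (f \in subalg_gen).
Proof. exact: asboolP. Qed.

Lemma mem_subalg_gen g : S g -> g \in subalg_gen.
Proof. by move=> Sg; apply/subalg_genP => B _ _ _; apply. Qed.

Fact subalg_gen1 : 1 \in subalg_gen.
Proof. by apply/subalg_genP. Qed.
Fact subalg_genM : GRing.mulr_2closed subalg_gen.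
Proof.
move=> f g /subalg_genP Bf /subalg_genP Bg; apply/subalg_genP => B B1 Bl Bm BS.
exact: (Bm _ _ (Bf B B1 Bl Bm BS) (Bg B B1 Bl Bm BS)).
Qed.
Fact subalg_gen_linear : GRing.linear_closed subalg_gen.
Proof.
move=> a f g /subalg_genP Bf /subalg_genP Bg; apply/subalg_genP => B B1 Bl Bm BS.
exact: (Bl a _ _ (Bf B B1 Bl Bm BS) (Bg B B1 Bl Bm BS)).
Qed.
Fact subalg_gen_subring : subring_closed subalg_gen.
Proof.
split; [exact: subalg_gen1 | | exact: subalg_genM].
move=> f g Bf Bg; rewrite addrC -scaleN1r; exact: subalg_gen_linear.
Qed.
Fact subalg_genZ : GRing.scaler_closed subalg_gen.
Proof.
move=> a f Bf; have -> : a *: f = (a - 1) *: f + f by rewrite scalerBl scale1r subrK.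
exact: subalg_gen_linear.
Qed.
HB.instance Definition _ := GRing.isSubringClosed.Build {linear V -> V} subalg_gen
  subalg_gen_subring.
HB.instance Definition _ := GRing.isScaleClosed.Build K {linear V -> V} subalg_gen
  subalg_genZ.

Record subalg := Subalg {
  subalg_val :> {linear V -> V}; _ : subalg_val \in subalg_gen }.
HB.instance Definition _ := [isSub for subalg_val].
HB.instance Definition _ := [Choice of subalg by <:].
HB.instance Definition _ :=
  GRing.SubChoice_isSubPzRing.Build {linear V -> V} subalg_gen subalg
    subalg_gen_subring.
HB.instance Definition _ := [SubZmodule_isSubLmodule of subalg by <:].
End GeneratedSubalgebra.

(* The indices 1 and 2 of gl_2. *)
Definition i1 : 'I_2 := ord0.
Definition i2 : 'I_2 := ord_max.

Section Holomorphic.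
Variables (K : numFieldType) (n : nat) (z m : 'I_n -> K).

Definition apoly : {poly K} := \prod_(i < n) ('X - (z i)%:P + (m i)%:P).
Definition dpoly : {poly K} := \prod_(i < n) ('X - (z i)%:P).

(* T a b s is the action of T_ab^{s}, with T_ab^{0} = delta_ab the constant term
   of T_ab(u).  The second clause is the coefficient of u^-r v^-s in
   (u-v)[T_ab(u),T_cd(v)] = T_cb(v)T_ad(u) - T_cb(u)T_ad(v); the remaining
   coefficients (those of u and v to the power 1) are trivially 0. *)
Definition yangian_action (V : lmodType K)
    (T : 'I_2 -> 'I_2 -> nat -> {linear V -> V}) : Prop :=
  (forall a b, T a b 0%N = (a == b)%:R) /\
  (forall a b c d r s,
    (T a b r.+1 * T c d s - T c d s * T a b r.+1)
      - (T a b r * T c d s.+1 - T c d s.+1 * T a b r)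
    = T c b s * T a d r - T c b r * T a d s).

(* The coefficient of u^(n-k) in d(u) * sum_(s >= 0) S_s u^-s.  As d is monic, an
   identity of series in 1/u may be multiplied by d(u): F(u) = G(u) / d(u) is
   stated below as equality of all coefficients of d(u) F(u) and G(u). *)
Definition mul_coef (V : lmodType K) (S : nat -> V) (k : nat) : V :=
  \sum_(j < k.+1 | (j <= n)%N) dpoly`_(n - j) *: S (k - j)%N.

Local Notation W := {mpoly K[n]}.

(* A Yangian action on C[x_1,...,x_n] with the defining properties of W_{a,d};
   these determine it uniquely.  The variable 'X_i is x_(i+1). *)
Record holomorphic_rep := HolomorphicRep {
  hT :> 'I_2 -> 'I_2 -> nat -> {linear W -> W};
  hT_yangian : yangian_action hT;
  hT12 : forall p k, mul_coef (fun s => hT i1 i2 s p) k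
           = \sum_(i < n | i.+1 == k) 'X_i * p;
  hT11 : forall k, mul_coef (fun s => hT i1 i1 s 1) k
           = (if (k <= n)%N then apoly`_(n - k) else 0)%:MP;
  hT22 : forall s, hT i2 i2 s 1 = (s == 0%N)%:R;
  hT21 : forall s, hT i2 i1 s 1 = 0 }.

Variable (T : holomorphic_rep).

Lemma T1_comm a b c d s : T a b 1%N * T c d s - T c d s * T a b 1%N
  = T c b s *+ (a == d) - T a d s *+ (c == b).
Proof.
have [T0 rel] := hT_yangian T; have := rel a b c d 0%N s; rewrite !T0.
by rewrite !mulr_natl !mulr_natr subrr subr0.
Qed.

(* e_22 = T_22^{1} acts on homogeneous polynomials as multiplication by the
   degree. *)
Lemma e22_hom l (p : W) : p \is l.-homog -> T i2 i2 1%N p = l%:R *: p.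
Proof.
have eX i (r : W) : T i2 i2 1%N ('X_i * r) = 'X_i * T i2 i2 1%N r + 'X_i * r.
  have X_E r0 : 'X_i * r0 = mul_coef (fun s => T i1 i2 s r0) i.+1.
    by rewrite hT12 (big_pred1 i) // => j; rewrite eqSS.
  rewrite !X_E /mul_coef linear_sum -big_split; apply: eq_bigr => j _ /=.
  rewrite linearZ -scalerDr; congr (_ *: _).
  have := T1_comm i2 i2 i1 i2 (i.+1 - j); rewrite eqxx mulr1n mulr0n subr0.
  by move/(congr1 (fun f : {linear W -> W} => f r)); rewrite linDE linNE !linME => /eqP; rewrite subr_eq addrC => /eqP.
have e1 : T i2 i2 1%N 1 = 0 :> W by rewrite hT22.
have eM (mon : 'X_{1..n}) : T i2 i2 1%N 'X_[mon] = (mdeg mon)%:R *: ('X_[mon] : W).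
  have [d] := ubnP (mdeg mon); elim: d mon => // d IH mon; rewrite ltnS => le_d.
  have [->|nz] := eqVneq mon 0%MM; first by rewrite mpolyX0 e1 mdeg0 scale0r.
  have [i nzi] : exists i, mon i != 0%N.
    by apply/existsP; apply: contraNT nz => /existsPn zmon; apply/eqP/mnmP => i;
      rewrite mnm0E; apply/eqP; have := zmon i; rewrite negbK.
  have le1 : (U_(i) <= mon)%MM by rewrite lep1mP.
  move: le_d; rewrite -(submK le1) addmC mdegD mdeg1 add1n => lt_d.
  rewrite mpolyXD eX IH // -scalerAr -natr1 scalerDl scale1r; congr (_ + _).
move=> hp; rewrite [p in LHS]mpolyE linear_sum [p in RHS]mpolyE scaler_sumr.
rewrite [LHS]big_seq [RHS]big_seq; apply: eq_bigr => mon mon_p.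
by rewrite linearZ /= eM (dhomog_mf hp) // !scalerA mulrC.
Qed.

Lemma e22_homog l (p : W) : T i2 i2 1%N p = l%:R *: p -> p \is l.-homog.
Proof.
move=> ep; apply/dhomogP => mon; rewrite mcoeff_msupp => nz.
have : (T i2 i2 1%N p)@_mon = (mdeg mon)%:R * p@_mon.
  rewrite [p in LHS]mpolyE linear_sum /= raddf_sum /=.
  transitivity (\sum_(k <- msupp p) (mdeg k)%:R * (p@_k *: 'X_[k])@_mon : K).
    apply: eq_bigr => k _; rewrite linearZ /= (@e22_hom (mdeg k)) ?dhomogX //.
    by rewrite scalerA mulrC -scalerA mcoeffZ.
  transitivity (\sum_(k <- msupp p) (mdeg mon)%:R * (p@_k *: 'X_[k])@_mon : K).
    apply: eq_bigr => k _; rewrite mcoeffZ mcoeffX.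
    by case: eqVneq => [->//|_]; rewrite !mulr0.
  by rewrite -mulr_sumr -raddf_sum /= -mpolyE.
rewrite ep mcoeffZ => /(mulIf nz)/eqP; rewrite eqr_nat => /eqP ->.
by [].
Qed.

(* T_11(u) + T_22(u) = (1/d(u)) sum_k Htilde_k u^(n-k). *)
Definition Htilde (k : nat) : {linear W -> W} :=
  mul_coef (fun s => T i1 i1 s + T i2 i2 s) k.

Variable l : nat.

(* e_12 acts as T_21^{1}. *)
Definition sing_pred : {pred W} :=
  [pred p : W | (p \is l.-homog) && (T i2 i1 1%N p == 0)].

Lemma sing_predE p : (p \in sing_pred) = (p \is l.-homog) && (T i2 i1 1%N p == 0).
Proof. by []. Qed.

Fact sing_submod : submod_closed sing_pred.
Proof.
split=> [|a p q]; first by rewrite sing_predE linear0 eqxx rpred0.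
rewrite !sing_predE => /andP[hp /eqP ep] /andP[hq /eqP eq].
by rewrite linearP ep eq scaler0 addr0 eqxx andbT rpredD ?rpredZ.
Qed.
HB.instance Definition _ := GRing.isSubmodClosed.Build K W sing_pred sing_submod.

Lemma Htilde_sing k p : p \in sing_pred -> Htilde k p \in sing_pred.
Proof.
rewrite !sing_predE => /andP[hp /eqP ep].
have com f g : f * g - g * f = 0 :> {linear W -> W} -> f (g p) = g (f p).
  by move/eqP; rewrite subr_eq0 => /eqP/(congr1 (fun h : {linear W -> W} => h p)).
have comH f : (forall s, f * (T i1 i1 s + T i2 i2 s)
      - (T i1 i1 s + T i2 i2 s) * f = 0) -> f (Htilde k p) = Htilde k (f p).
  move=> cf; apply: com; rewrite /Htilde /mul_coef mulr_sumr mulr_suml -sumrB.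
  by rewrite big1 // => j _; rewrite lin_commZ cf scaler0.
apply/andP; split.
  apply: e22_homog; rewrite comH ?(e22_hom hp) ?linearZ // => s.
  by rewrite mulrDr mulrDl opprD addrACA !T1_comm !subrr addr0.
apply/eqP; rewrite comH ?ep ?linear0 // => s.
by rewrite mulrDr mulrDl opprD addrACA !T1_comm /= subr0 sub0r addNr.
Qed.

Record Sing := MkSing { sing_val :> W; _ : sing_val \in sing_pred }.
HB.instance Definition _ := [isSub for sing_val].
HB.instance Definition _ := [Choice of Sing by <:].
HB.instance Definition _ := [SubChoice_isSubLmodule of Sing by <:].

Definition Hfun (k : nat) (p : Sing) : Sing := MkSing (Htilde_sing k (valP p)).
Fact Hfun_linear k : linear (Hfun k).
Proof. by move=> a p q; apply: val_inj; rewrite /= !linearP. Qed.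
HB.instance Definition _ k :=
  GRing.isLinear.Build K Sing Sing _ (Hfun k) (Hfun_linear k).
Definition H (k : nat) : {linear Sing -> Sing} := Hfun k.

Definition bethe_alg := subalg (fun f => exists2 k, (1 <= k <= n)%N & f = H k).
HB.instance Definition _ := GRing.PzRing.on bethe_alg.
HB.instance Definition _ := GRing.Lmodule.on bethe_alg.
End Holomorphic.

(* The variables y_0, ..., y_(n-1) (n >= 1): 'X_ord0 is y_0 and
   'X_(lift ord0 j) is y_(j+1).  Comparing coefficients in
   sum_i x_i u^(n-i) = y_0 prod_j (u - y_j) gives each x_i as a polynomial in the
   y's; Om \mPo x_of_y is Om rewritten in the y's. *)
Section Weight.
Variables (A : comNzRingType) (n l : nat).
Local Notation y0 := ('X_ord0 : {mpoly A[n.-1.+1]}).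
Local Notation y j := ('X_(lift ord0 j) : {mpoly A[n.-1.+1]}).

Definition xpoly_y : {poly {mpoly A[n.-1.+1]}} :=
  y0 *: \prod_(j < n.-1) ('X - (y j)%:P).
Definition x_of_y : n.-tuple {mpoly A[n.-1.+1]} :=
  [tuple xpoly_y`_(n.-1 - i) | i < n].

Lemma monic_charpoly (P : {poly A}) : P \is monic -> size P = l.+1 ->
  {M : 'M[A]_l | char_poly M = P}.
Proof.
move=> Pm sP; have e : (size P).-1 = l by rewrite sP.
by case: _ / e; exists (companionmx P); apply: companionmxK.
Qed.

Lemma dhomog_prod1 N k (F : 'I_k -> {mpoly A[N]}) :
  (forall i, F i \is 1.-homog) -> \prod_i F i \is k.-homog.
Proof.
elim: k F => [|k IH] F hF; first by rewrite big_ord0 dhomog1.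
rewrite big_ord_recr; have := dhomogM (IH (fun i => F (widen_ord (leqnSn k) i)) _) (hF ord_max).
by rewrite addn1 /=; apply=> i; apply: hF.
Qed.

Lemma xpoly_matrix (N : 'M[{mpoly A[n.-1.+1]}]_l) : (0 < n)%N ->
  \sum_(i < n) ((-1) ^+ n.-1 * xpoly_y`_(n.-1 - i)) *: (N ^+ (n.-1 - i))
  = y0 *: \prod_(j < n.-1) ((y j)%:M - N).
Proof.
move=> n_gt0; case: l N => [|l'] N; first by rewrite [LHS]flatmx0 [RHS]flatmx0.
have [n' e] : exists n', n = n'.+1 by exists n.-1; rewrite prednK.
have sY : (size xpoly_y <= n)%N.
  rewrite (leq_trans (size_scale_leq _ _)) // size_prod_XsubC.
  by rewrite /index_enum -enumT size_enum_ord prednK.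
have -> : \sum_(i < n) ((-1) ^+ n.-1 * xpoly_y`_(n.-1 - i)) *: (N ^+ (n.-1 - i))
   = (-1) ^+ n.-1 *: horner_mx N xpoly_y.
  rewrite (reindex_inj rev_ord_inj) /horner_mx /horner_morph.
  rewrite (@horner_coef_wide _ n); last first.
    exact: leq_trans (size_poly _ _) sY.
  rewrite scaler_sumr; apply: eq_bigr => i _; rewrite -scalerA; congr (_ *: _).
  have -> : (n.-1 - rev_ord i)%N = i by have := ltn_ord i; rewrite /=; move: (nat_of_ord i) => i0; rewrite e /= subSS ltnS => /subKn-> .
  rewrite coef_map_id0 ?raddf0 //; exact/esym/mul_scalar_mx.
rewrite /xpoly_y linearZ /= rmorph_prod scalerA mulrC -scalerA; congr (_ *: _).
have -> : (-1) ^+ n.-1 = (-1) ^+ #|'I_n.-1| :> {mpoly A[n.-1.+1]} by rewrite card_ord.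
rewrite -scaler_prodl; apply: eq_bigr => j _.
by rewrite rmorphB /= horner_mx_X horner_mx_C scaleN1r opprB.
Qed.

(* If P = det(u - M) then y_0^l prod_j P(y_j) is
   det(sum_i (-1)^(n-1) x_i M^(n-i)). *)
Lemma weight_exists (P : {poly A}) : P \is monic -> size P = l.+1 ->
  {Om : {mpoly A[n]} | (0 < n)%N -> Om \is l.-homog /\
    Om \mPo x_of_y = y0 ^+ l * \prod_(j < n.-1) (map_poly (@mpolyC _ A) P).[y j]}.
Proof.
move=> Pm sP; have [M MP] := monic_charpoly Pm sP.
pose Mx := map_mx (@mpolyC n A) M.
exists (\det (\sum_(i < n) ((-1) ^+ n.-1 * 'X_i : {mpoly A[n]}) *: (Mx ^+ (n.-1 - i)))).
move=> n_gt0.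
have mapX k (f : {rmorphism A -> {mpoly A[k]}}) e : map_mx f M ^+ e = map_mx f (M ^+ e).
  elim: e => [|e IH]; first by rewrite !expr0 map_mx1.
  by rewrite !exprS IH map_mxM.
split.
  apply: rpred_sum => s _.
  have h : \prod_i (\sum_(i0 < n) ((-1) ^+ n.-1 * 'X_i0 : {mpoly A[n]})
      *: Mx ^+ (n.-1 - i0)) i (s i) \is l.-homog.
    apply: dhomog_prod1 => i; rewrite summxE; apply: rpred_sum => k _.
    rewrite mxE /Mx mapX mxE mulrC mul_mpolyC rpredZ // -signr_odd.
    by case: (odd _); rewrite ?mul1r ?mulN1r ?rpredN dhomogX; apply/eqP/mdeg1.
  by case: (odd_perm s); rewrite ?mul1r ?mulN1r ?rpredN.
pose f : {rmorphism {mpoly A[n]} -> {mpoly A[n.-1.+1]}} := comp_mpoly x_of_y.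
pose N := map_mx (@mpolyC n.-1.+1 A) M.
have Mf e : map_mx f (Mx ^+ e) = N ^+ e.
  rewrite /Mx /N !mapX -map_mx_comp; apply/matrixP => i j; rewrite !mxE /=.
  exact: comp_mpolyC.
rewrite -[LHS]/(f _) -det_map_mx.
have -> : map_mx f (\sum_(i < n) ((-1) ^+ n.-1 * 'X_i : {mpoly A[n]}) *: (Mx ^+ (n.-1 - i)))
  = y0 *: \prod_(j < n.-1) ((y j)%:M - N).
  rewrite -xpoly_matrix // raddf_sum; apply: eq_bigr => i _ /=.
  rewrite map_mxZ Mf rmorphM rmorph_sign [f 'X_i]comp_mpolyXU.
  by rewrite -tnth_nth tnth_mktuple.
rewrite detZ; congr (_ * _).
rewrite (big_morph _ (@det_mulmx _ _) (@det1 _ _)); apply: eq_bigr => j _.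
rewrite -MP map_char_poly -/N /char_poly -[RHS]/(horner_eval _ _) -det_map_mx.
congr (\det _); apply/matrixP => i k; rewrite !mxE /= /horner_eval.
by rewrite hornerD hornerN hornerC hornerMn hornerX.
Qed.
End Weight.

Section BetheQuotient.
Variables (K : numFieldType) (n l : nat) (z m : 'I_n -> K).
Local Notation S := {mpoly K[l + n]}.
Local Notation y0 := ('X_ord0 : {mpoly S[n.-1.+1]}).
Local Notation y j := ('X_(lift ord0 j) : {mpoly S[n.-1.+1]}).

(* In C[a,h] the first l variables are a_1..a_l, the last n are h_1..h_n; avar
   and hvar are indexed from 1, and are 0 outside the range. *)
Definition avar (s : nat) : S := \sum_(i < l | i.+1 == s) 'X_(lshift n i).
Definition hvar (s : nat) : S := \sum_(i < n | i.+1 == s) 'X_(rshift l i).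

Definition ppoly : {poly S} :=
  'X^l + \sum_(1 <= s < l.+1) (avar s)%:P * 'X^(l - s).
Definition Bpoly : {poly S} :=
  2%:P * 'X^n + \sum_(1 <= s < n.+1) (hvar s)%:P * 'X^(n - s).

Definition Dpoly : {poly S} :=
  map_poly (@mpolyC _ K) (dpoly z) * ppoly
  - Bpoly * (ppoly \Po ('X - 1%:P))
  + map_poly (@mpolyC _ K) (apoly z m) * (ppoly \Po ('X - 2%:P)).

(* q_i for 1 <= i <= l + n. *)
Definition qrel (i : nat) : S :=
  match i with
  | 1 => hvar 1 - (\sum_i (m i - 2 * z i))%:MP
  | 2 => hvar 2 - (l%:R * (l%:R - 1 - \sum_i m i))%:MP
         - (\sum_(i < n) \sum_(j < n | (i < j)%N)
              (z i * z j + (z i - m i) * (z j - m j)))%:MP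
  | _ => Dpoly`_(l + n - i)
  end.

Definition AD := quot_alg (fun i : 'I_(l + n) => qrel i.+1).
HB.instance Definition _ := GRing.ComPzRing.on AD.
HB.instance Definition _ := GRing.Lmodule.on AD.
Definition AD_class : S -> AD := @qpi _ _ _ _.

Lemma size_ppoly : size ppoly = l.+1.
Proof.
rewrite size_polyDl size_polyXn // ltnS (leq_trans (size_sum _ _ _)) //.
rewrite big_seq; elim/big_ind: _ => // [x y'|s]; first by rewrite geq_max => -> ->.
rewrite mem_index_iota => /andP[s1 s2]; rewrite mul_polyC (leq_trans (size_scale_leq _ _)) //.
by rewrite size_polyXn -subSn // leq_subLR addnC -addn1 leq_add2l.
Qed.

Lemma ppoly_monic : ppoly \is monic.
Proof.
rewrite monicE lead_coefE size_ppoly /= coefD coefXn eqxx coef_sum big_nat.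
rewrite big1 ?addr0 // => s /andP[s1 s2]; rewrite coefCM coefXn.
have lt_ls : (l - s < l)%N by rewrite ltn_subrL s1 (leq_trans s1).
by rewrite gtn_eqF ?mulr0.
Qed.

(* The universal weight function, over C[a,h] instead of its subring C[a], is
   determined by this property, the x_i being algebraically independent as
   polynomials in the y's. *)
Lemma omega_exists : {Om : {mpoly S[n]} | (0 < n)%N -> Om \is l.-homog /\
  Om \mPo x_of_y _ n = y0 ^+ l *
    \prod_(j < n.-1) (map_poly (@mpolyC _ S) ppoly).[y j - 1]}.
Proof.
have s2 : size ('X - 1%:P : {poly S}) = 2 by rewrite size_XsubC.
have Pm : ppoly \Po ('X - 1%:P) \is monic.
  rewrite monicE lead_coef_comp ?s2 // lead_coefXsubC expr1n mulr1 -monicE; exact: ppoly_monic.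
have Ps : size (ppoly \Po ('X - 1%:P)) = l.+1 by rewrite size_comp_poly2 // size_ppoly.
have [Om h] := weight_exists n Pm Ps; exists Om => /h[h1 ->]; split=> //.
congr (_ * _); apply: eq_bigr => j _.
by rewrite map_comp_poly horner_comp rmorphB /= map_polyX map_polyC !hornerE.
Qed.

Definition omega : {mpoly S[n]} := sval omega_exists.

(* (id (x) g)(omega_D).  A tensor in W (x) C[a,h] is a polynomial in x with
   coefficients in C[a,h]; omega_D is obtained by taking the classes of the
   coefficients of omega in A_D, and id (x) g applies g to those classes. *)
Definition weight_pairing (g : {linear AD -> K^o}) : {mpoly K[n]} :=
  map_mpoly (fun c : S => g (AD_class c)) omega.

Definition separating : Prop := forall s : nat, (1 <= s <= l)%N ->
  \sum_i m i - 2 * l%:R + 1 + s%:R != 0.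

(* psi is an epimorphism of unital algebras A_D -> A_W mapping h_s to H_s. *)
Definition is_psi_DW (T : holomorphic_rep z m)
    (psi : {rmorphism AD -> bethe_alg T l}) : Prop :=
  [/\ scalable psi, (forall F, exists f, psi f = F) &
      forall s, (1 <= s <= n)%N ->
        subalg_val (psi (AD_class (hvar s))) = H T l s].
End BetheQuotient.

(* Main.v *)
(* Separation of variables. Regard an element of W as a function of the polynomial
   x(u) = sum_i x_i u^(n-i). At x(u) = (t - u) q(u) multiplication by T_12(t)
   vanishes, and the Yangian relations then force d(t) T_11(t) and d(t) T_22(t) to act
   as a(t) and d(t) times the shifts of t by -1 and +1. So t |-> v((t - u) q(u))
   satisfies Baxter's equation, with the operators H_k in place of the numbers h_k.

   At the points c prod_j (t_j - u) the element tau(g) is g of a product of the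
   p(t_j - 1), which solve the same equation modulo I_D; interpolating at the t_j
   gives H_k tau(g) = tau(L_{h_k}^* g). As H_2 is x_1 e_12 plus a constant, tau(g) is
   singular. If tau(g) = 0, then g(f prod_j p(t_j - 1)) = 0 for all f and t_j, and
   taking leading coefficients in the t_j gives g(f) = 0.

   Conversely let v be singular. The indicial coefficients
   s (sum_i m_i - 2 l + 1 + s) do not vanish, so Baxter's equation expresses every
   coefficient of t |-> v((t - u) q(u)) as the leading coefficient v(q) of the same
   polynomial for another singular vector, obtained from v by a polynomial in the H_k.
   This turns Sing into an A_D-module, and the functional sending f to the value of
   f v at x(u) = (-1)^(n-1) is a preimage of v under tau. *)

Require Import Defs.
From HB Require Import structures.
From mathcomp Require Import all_boot all_order all_algebra.
From mathcomp.classical Require Import boolp classical_sets.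
From mathcomp Require Import reals complex mpoly ring.
Set Implicit Arguments.
Unset Strict Implicit.
Unset Printing Implicit Defensive.
Import GRing.Theory Num.Theory.
Local Open Scope ring_scope.

(** * Functionals and evaluation of polynomials *)

Section Functionals.
Variables (K : fieldType) (V : lmodType K).

(* A subspace maximal among those avoiding x is a complement of the line K x. *)
Lemma exists_functional (x : V) : x != 0 ->
  exists g : {linear V -> K^o}, g x != 0.
Proof.
move=> x_neq0.
pose P (A : set V) := (forall a u v, A u -> A v -> A (a *: u + v)) /\ ~ A x.
have [|A [[Alin Ax] Amax]] := @Zorn_bigcup V P.
  move=> F FP Ftot; split=> [a u v [X FX Xu] [Y FY Yv]|[X FX Xx]]; last first.
    by have [_ /(_ Xx)] := FP _ FX.
  have [XY|YX] := Ftot _ _ FX FY.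
    by exists Y => //; have [Yl _] := FP _ FY; apply: Yl => //; apply: XY.
  by exists X => //; have [Xl _] := FP _ FX; apply: Xl => //; apply: YX.
(* The empty set satisfies [P], as the union of an empty chain must, so that 0 lies in [A] has to be
   drawn from maximality. *)
have A0 : A 0.
  apply: contrapT => nA0.
  apply: (Amax (A `|` [set 0])%classic).
    split; [by apply: subsetUl | by move=> /(_ 0) h; apply/nA0/h; right].
  split=> [a u v|[//|/eqP]]; last by rewrite (negPf x_neq0).
  case=> [Au|->]; case=> [Av|->]; rewrite ?scaler0 ?addr0 ?add0r.
  - by left; apply: Alin.
  - have /= := Alin (-1) u u Au Au; rewrite scaleN1r addNr => /nA0[].
  - by left.
  - by right.
have AZ a u : A u -> A (a *: u).
  by move=> Au; rewrite -[_ *: _]addr0; apply: Alin.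
have AD u v : A u -> A v -> A (u + v).
  by move=> Au Av; rewrite -[u]scale1r; apply: Alin.
have decomp v : exists c, A (v - c *: x).
  apply: contrapT => nex.
  have nAv : ~ A v by move=> Av; apply: nex; exists 0; rewrite scale0r subr0.
  (* [B] is A + K v. By maximality it must contain x, and a membership of x - c v in [A] with c
     nonzero can be solved for v. *)
  pose B : set V := fun w => exists c, A (w - c *: v).
  apply: (Amax B).
    split=> [w Aw|/(_ v) BA]; first by exists 0; rewrite scale0r subr0.
    by apply/nAv/BA; exists 1; rewrite scale1r subrr.
  split=> [a u w [c Ac] [d Ad]|[c Ac]].
    exists (a * c + d); have := Alin a _ _ Ac Ad.
    by rewrite scalerBr scalerA addrACA -opprD -scalerDl.
  have [c0|c_neq0] := eqVneq c 0; first by move: Ac; rewrite c0 scale0r subr0.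
  apply: nex; exists c^-1; have := AZ (- c^-1) _ Ac.
  by rewrite scalerBr scalerA mulNr mulVf // !scaleNr scale1r opprK addrC.
have /choice [f fP] := decomp.
have f_uniq v c : A (v - c *: x) -> f v = c.
  move=> Ac; apply/eqP; rewrite -subr_eq0; apply/negP => /negP fc.
  have := AD _ _ Ac (AZ (-1) _ (fP v)).
  rewrite scaleN1r opprB addrC addrA subrK -scalerBl => /(AZ (f v - c)^-1).
  by rewrite scalerA mulVf // scale1r.
have flin : linear (f : V -> K^o).
  move=> a u v; apply: f_uniq; have := Alin a _ _ (fP u) (fP v).
  by rewrite scalerBr scalerA addrACA -opprD -scalerDl.
pose g0 : V -> K^o := f.
pose m := GRing.isLinear.Build K V K^o _ g0 flin.
pose g : {linear V -> K^o} := HB.pack g0 m.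
have gx : f x = 1 by apply: f_uniq; rewrite scale1r subrr.
by exists g; apply/negP => /eqP; rewrite -[LHS]/(f x) gx => /eqP; rewrite oner_eq0.
Qed.

End Functionals.

Section Vanishing.
Variable K : numDomainType.

(** Of the first [size p + size s] natural numbers at least [size p] avoid [s], too many roots for a
    nonzero [p]. *)
Lemma poly_eq0_horner (p : {poly K}) (s : seq K) :
  (forall t, t \notin s -> p.[t] = 0) -> p = 0.
Proof.
move=> p0; apply/eqP/contraT => nz.
have h : all (root p) [seq t <- [seq i%:R | i <- iota 0 (size p + size s)] | t \notin s].
  by apply/allP => t; rewrite mem_filter => /andP[ts _]; apply/rootP/p0.
have u : uniq ([seq i%:R | i <- iota 0 (size p + size s)] : seq K).
  rewrite map_inj_uniq ?iota_uniq // => i j /eqP; rewrite eqr_nat => /eqP //.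
have := max_poly_roots nz h (filter_uniq _ u); rewrite ltnNge size_filter => /negP[].
set r := [seq _ | _ <- _] in u *.
have sr : size r = (size p + size s)%N by rewrite size_map size_iota.
rewrite -(leq_add2r (size s)) -sr -(count_predC (fun t => t \notin s) r) leq_add2l.
rewrite -size_filter uniq_leq_size ?filter_uniq // => t.
by rewrite mem_filter /= negbK => /andP[].
Qed.

Lemma muni_inj n (p : {mpoly K[n.+1]}) : muni p = 0 -> p = 0.
Proof.
move=> p0; apply/mpolyP => mon; rewrite mcoeff0.
have <- : (muni p)`_(mon ord_max)@_[multinom mon (widen_ord (leqnSn n) i) | i < n] = 0.
  by rewrite p0 coef0 raddf0.
rewrite muniE coef_sum raddf_sum /=.
rewrite [p in LHS]mpolyE raddf_sum /=; apply: eq_bigr => k _.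
rewrite coefZ coefXn !mcoeffZ mcoeffX.
have -> : (k == mon) = (mon ord_max == k ord_max) &&
   ([multinom k (widen_ord (leqnSn n) i) | i < n]
     == [multinom mon (widen_ord (leqnSn n) i) | i < n]).
  apply/eqP/andP => [->|[/eqP kmax /eqP km]]; first by rewrite !eqxx.
  apply/mnmP => i; have [->//|ni] := eqVneq i ord_max.
  have li : (i < n)%N by rewrite ltn_neqAle -ltnS ltn_ord -val_eqE /= in ni *; rewrite ni.
  have /mnmP/(_ (Ordinal li)) := km; rewrite !mnmE.
  by have -> : widen_ord (leqnSn n) (Ordinal li) = i by apply: val_inj.
case: eqP => _ /=; last by rewrite !mulr0 raddf0.
by rewrite mulr1 mcoeffZ mcoeffX.
Qed.

Lemma meval_muni n (p : {mpoly K[n.+1]}) (v : 'I_n.+1 -> K) :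
  p.@[v] = (map_poly (meval (fun i : 'I_n => v (widen_ord (leqnSn n) i))) (muni p)).[v ord_max].
Proof.
rewrite muniE raddf_sum /= horner_sum mevalE; apply: eq_bigr => mon _.
rewrite map_polyZ /= map_polyXn hornerZ hornerXn mevalZ mevalX -mulrA; congr (_ * _).
by rewrite big_ord_recr /=; congr (_ * _); apply: eq_bigr => i _; rewrite mnmE.
Qed.

(** Induction on the number of variables: fixing all variables but the last leaves a univariate
    polynomial with only zero values, so each coefficient of [muni p] vanishes everywhere. *)
Lemma mpoly_eq0_meval n (p : {mpoly K[n]}) : (forall v, p.@[v] = 0) -> p = 0.
Proof.
elim: n p => [|n IH] p p0.
  by have := p0 (fun=> 0); rewrite (nvar0_mpolyC p) mevalC => ->; rewrite mpolyC0.
apply: muni_inj; apply/polyP => i; rewrite coef0; apply: IH => v.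
rewrite -[LHS](coef_map (meval v)) (@poly_eq0_horner (map_poly (meval v) (muni p)) [::]) ?coef0 // => t _.
pose v' (i : 'I_n.+1) := if insub (val i) is Some j then v j else t.
have := p0 v'; rewrite meval_muni /v' insubN ?ltnn // => h; rewrite -[RHS]h; congr (_.[t]).
apply: eq_map_poly => q; apply: meval_eq => j /=.
by rewrite insubT //= => lt; congr (v _); apply: val_inj.
Qed.
End Vanishing.

(** * Elements of W as functions of the polynomial x(u) *)

Section Evaluation.
Variables (K : numFieldType) (n : nat).
Local Notation W := {mpoly K[n]}.

(* The point of W where sum_i x_i u^(n-i) is the polynomial q (of size <= n). *)
Definition ev (q : {poly K}) (w : W) : K := w.@[fun i : 'I_n => q`_(n.-1 - i)].

HB.instance Definition _ q := GRing.RMorphism.copy (ev q) (meval (fun i : 'I_n => q`_(n.-1 - i))).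
HB.instance Definition _ q := GRing.isScalable.Build K W K *%R (ev q) (@mevalZ _ _ _).

Lemma evX q (i : 'I_n) : ev q 'X_i = q`_(n.-1 - i).
Proof. by rewrite /ev mevalXU. Qed.

Lemma evZ q a (w : W) : ev q (a *: w) = a * ev q w.
Proof. exact: mevalZ. Qed.

Lemma evC q a : ev q a%:MP = a.
Proof. exact: mevalC. Qed.

(** The restriction of [w] to the line of points (t - u) q(u), as a polynomial in t. *)
Definition line (q : {poly K}) (w : W) : {poly K} :=
  mmap (@polyC K) (fun i : 'I_n => q`_(n.-1 - i) *: 'X - (('X * q)`_(n.-1 - i))%:P) w.
HB.instance Definition _ q := GRing.RMorphism.copy (line q)
  (mmap (@polyC K) (fun i : 'I_n => q`_(n.-1 - i) *: 'X - (('X * q)`_(n.-1 - i))%:P)).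

Lemma lineZ q a (w : W) : line q (a *: w) = a *: line q w.
Proof. by rewrite /line mmapZ /= mul_polyC. Qed.
HB.instance Definition _ q := GRing.isScalable.Build K W {poly K} *:%R (line q) (@lineZ q).

Lemma horner_line q w t : (line q w).[t] = ev ((t%:P - 'X) * q) w.
Proof.
rewrite /line /mmap /ev mevalE horner_sum; apply: eq_bigr => mon _.
rewrite hornerM hornerC /mmap1 horner_prod; congr (_ * _); apply: eq_bigr => i _.
by rewrite horner_exp !hornerE mulrBl coefB coefCM mulrC.
Qed.

Lemma size_coef_prod (R : nzSemiRingType) (p q : {poly R}) (j k : nat) : (size p <= j.+1)%N ->
  (size q <= k.+1)%N -> (size (p * q)%R <= (j + k).+1)%N /\ (p * q)`_(j + k) = p`_j * q`_k.
Proof.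
move=> sp sq; split.
  apply: leq_trans (size_polyMleq _ _) _; rewrite -subn1 leq_subLR add1n.
  by rewrite (leq_trans (leq_add sp sq)) // addSn addnS.
have jk : (j < (j + k).+1)%N by rewrite ltnS leq_addr.
rewrite coefM (bigD1 (Ordinal jk)) //= addKn big1 ?addr0 // => i; rewrite -val_eqE /= => ij.
have [lt_ij|lt_ji|eq_ij] := ltngtP i j; last by rewrite eq_ij eqxx in ij.
  rewrite [q`_ _]nth_default ?mulr0 // (leq_trans sq) //.
  by rewrite ltn_subRL ltn_add2r.
by rewrite nth_default ?mul0r // (leq_trans sp).
Qed.

(** Each coordinate of (t - u) q(u) is affine in t, with slope the same coordinate of q. A monomial
    of degree l therefore has degree at most l in t, and its coefficient of t^l is its value at
    q. *)
Lemma line_homog l q (w : W) : w \is l.-homog ->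
  (size (line q w) <= l.+1)%N /\ (line q w)`_l = ev q w.
Proof.
move=> /dhomogP hw.
pose h (i : 'I_n) : {poly K} := q`_(n.-1 - i) *: 'X - (('X * q)`_(n.-1 - i))%:P.
have hX i (e : nat) : (size (h i ^+ e)%R <= e.+1)%N /\ (h i ^+ e)`_e = q`_(n.-1 - i) ^+ e.
  elim: e => [|e [IHs IHc]]; first by rewrite !expr0 size_poly1 coef1.
  have sh : (size (h i) <= 2)%N.
    rewrite (leq_trans (size_polyD _ _)) // geq_max size_polyN.
    by rewrite (leq_trans (size_scale_leq _ _)) ?size_polyX // (leq_trans (size_polyC_leq1 _)).
  have [] := size_coef_prod sh IHs; rewrite !exprS IHc add1n => -> ->; split=> //.
  by rewrite /h !coefE mulr1 subr0.
have hm (mon : 'X_{1..n}) : (size (mmap1 h mon) <= (mdeg mon).+1)%N /\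
    (mmap1 h mon)`_(mdeg mon) = \prod_(i < n) q`_(n.-1 - i) ^+ mon i.
  rewrite mdegE /mmap1; elim/big_ind3: _ => [|p1 n1 x1 p2 n2 x2 [s1 <-] [s2 <-]|i _].
  - by rewrite size_poly1 coef1.
  - exact: size_coef_prod.
  - exact: hX.
rewrite /line /mmap /ev mevalE; split.
  apply: leq_trans (size_sum _ _ _) _; rewrite big_seq.
  elim/big_ind: _ => // [a b|mon /hw <-]; first by rewrite geq_max => -> ->.
  by rewrite mul_polyC (leq_trans (size_scale_leq _ _)) // (hm mon).1.
rewrite coef_sum !big_seq; apply: eq_bigr => mon /hw <-.
by rewrite coefCM (hm mon).2.
Qed.

Lemma ev_homog l q c (w : W) : w \is l.-homog -> ev (c *: q) w = c ^+ l * ev q w.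
Proof.
move=> /dhomogP hw; rewrite /ev !mevalE mulr_sumr !big_seq; apply: eq_bigr => mon /hw lm.
rewrite mulrCA; congr (_ * _); rewrite -[l](lm : mdeg mon = l) mdegE -prodrXr -big_split /=.
by apply: eq_bigr => i _; rewrite coefZ exprMn.
Qed.

(* One factor at a time: a polynomial in t vanishing off a finite set is zero. *)
Lemma ev_prod_uniq (w : W) N : (forall c (s : seq K), size s = N -> uniq s ->
   ev (c *: \prod_(t <- s) (t%:P - 'X)) w = 0) ->
  forall c (s : seq K), size s = N -> ev (c *: \prod_(t <- s) (t%:P - 'X)) w = 0.
Proof.
move=> w0 c s; rewrite -[s]cats0; have : uniq ([::] : seq K) by [].
elim: s [::] => [|t s IH] r ur; first by move=> sr; apply: w0.
move=> sz.
suff l0 : line (c *: \prod_(t <- s ++ r) (t%:P - 'X)) w = 0.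
  by rewrite big_cons scalerAr -horner_line l0 horner0.
apply: (@poly_eq0_horner _ _ r) => t' t'r; rewrite horner_line -scalerAr.
have sz' : size (s ++ t' :: r) = N by rewrite -sz !size_cat /= addnS.
have ur' : uniq (t' :: r) by rewrite /= t'r ur.
have h := IH _ ur' sz'; rewrite -[RHS]h; congr (ev (_ *: _) _).
by rewrite !big_cat big_cons mulrCA.
Qed.
End Evaluation.

(** Over an algebraically closed field every polynomial of degree exactly n - 1 is a constant times
    a product of factors t_j - u. The hypothesis thus covers all points with x_1 nonzero, once
    coinciding t_j are allowed by [ev_prod_uniq]. *)
Lemma ev_eq0 (K : numClosedFieldType) n (w : {mpoly K[n]}) : (0 < n)%N ->
  (forall c (s : seq K), size s = n.-1 -> uniq s ->
     ev (c *: \prod_(t <- s) (t%:P - 'X)) w = 0) -> w = 0.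
Proof.
move=> n_gt0 /ev_prod_uniq w0; pose i0 := Ordinal n_gt0.
have X0 : ('X_i0 : {mpoly K[n]}) != 0.
  apply/eqP => /(congr1 (mcoeff U_(i0)%MM)); rewrite mcoeffX eqxx raddf0 => /eqP.
  by rewrite oner_eq0.
(* Multiplying by x_1 takes care of the remaining points, those with x_1 = 0. *)
apply/(mulfI X0); rewrite mulr0; apply: mpoly_eq0_meval => v.
rewrite mevalM mevalXU; have [->|v0] := eqVneq (v i0) 0; first by rewrite mul0r.
pose P := \sum_(i < n) v i *: 'X^(n.-1 - i).
have coefP (i : 'I_n) : P`_(n.-1 - i) = v i.
  rewrite coef_sum (bigD1 i) //= coefZ coefXn eqxx mulr1 big1 ?addr0 // => j ji.
  rewrite coefZ coefXn [_ == _](_ : _ = false) ?mulr0 //.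
  have le (k : 'I_n) : (k <= n.-1)%N by rewrite -ltnS prednK.
  apply: contraNF ji => /eqP/(congr1 (subn n.-1)); rewrite !subKn // => ij.
  by apply/eqP/val_inj.
have sP : size P = n.
  apply/eqP; rewrite eqn_leq; apply/andP; split.
    apply/leq_sizeP => j nj; rewrite coef_sum big1 // => i _.
    rewrite coefZ coefXn gtn_eqF ?mulr0 //.
    by rewrite (leq_ltn_trans (leq_subr _ _)) // prednK.
  rewrite leqNgt; apply: contra v0 => sP; rewrite -coefP nth_default //= subn0.
  by rewrite -ltnS prednK.
have [r Pr] := closed_field_poly_normal P.
have lP : lead_coef P != 0 by rewrite lead_coef_eq0 -size_poly_eq0 sP -lt0n.
have sr : size r = n.-1.
  by have := congr1 (fun p : {poly K} => size p) Pr; rewrite size_scale // size_prod_XsubC sP => ->.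
have := w0 (lead_coef P * (-1) ^+ size r) r sr; rewrite -scalerA.
have -> : (-1) ^+ size r *: \prod_(t <- r) (t%:P - 'X) = \prod_(t <- r) ('X - t%:P).
  elim: r {Pr sr} => [|t r IH]; first by rewrite !big_nil scale1r.
  by rewrite !big_cons -IH exprS -scalerA scaleN1r -scalerN -mulNr opprB scalerAr.
rewrite -Pr /ev => h; rewrite -[RHS](mulr0 (v i0)) -h; congr (_ * _).
by apply: meval_eq => i; rewrite coefP.
Qed.

(** * Yangian relations and Baxter's equation *)

Section PowerSums.
Variable K : numFieldType.

Lemma prod_XsubC_top (s : seq K) (p := \prod_(c <- s) ('X - c%:P)) (N := size s)
    (e1 := \sum_(c <- s) c) (e2 := \sum_(c <- s) c ^+ 2) :
  [/\ size p = N.+1, p`_N = 1, (0 < N)%N -> p`_N.-1 = - e1 &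
      (1 < N)%N -> p`_N.-2 = (e1 ^+ 2 - e2) / 2].
Proof.
(* The factor X^2 keeps all three indices nonnegative, so that the induction needs no separate
   treatment of short lists. *)
suff [p2 p1 p0] : [/\ ('X^2 * p)`_N.+2 = 1, ('X^2 * p)`_N.+1 = - e1 &
    ('X^2 * p)`_N = (e1 ^+ 2 - e2) / 2].
  move: p0 p1 p2; rewrite !coefXnM => p0 p1 p2; split.
  - exact: size_prod_XsubC.
  - by rewrite -p2 subSS subSS subn0.
  - by move: p1; case: N {p0 p2} => // k <- _; rewrite /= !subSS subn0.
  - by move: p0; case: N {p1 p2} => [|[|k]] // <- _; rewrite /= !subSS subn0.
rewrite {}/p {}/N {}/e1 {}/e2; elim: s => [|c s [IH2 IH1 IH0]] /=.
  by rewrite !big_nil mulr1 !coefXn /= expr0n subrr mul0r oppr0.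
have IH3 : ('X^2 * \prod_(c <- s) ('X - c%:P))`_(size s).+3 = 0.
  by rewrite coefXnM !subSS subn0 nth_default // size_prod_XsubC.
rewrite !big_cons mulrCA mulrBl !coefB !coefXM !coefCM /= IH0 IH1 IH2 IH3.
have two : (2 : K) != 0 by rewrite pnatr_eq0.
by split; [rewrite mulr0 subr0 | rewrite mulr1 opprD addrC | field].
Qed.

Lemma sum_ltn_mul n (f : 'I_n -> K) :
  \sum_(i < n) \sum_(j < n | (i < j)%N) f i * f j
  = ((\sum_i f i) ^+ 2 - \sum_i f i ^+ 2) / 2.
Proof.
have two : (2 : K) != 0 by rewrite pnatr_eq0.
elim: n f => [|n IH] f; first by rewrite !big_ord0 expr0n subrr mul0r.
rewrite big_ord_recl /= [X in _ + X](_ : _ = \sum_(i < n) \sum_(j < n | (i < j)%N)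
  f (lift ord0 i) * f (lift ord0 j)); last first.
  by apply: eq_bigr => i _; rewrite big_mkcond big_ord_recl /= add0r -big_mkcond.
rewrite IH big_mkcond big_ord_recl /= add0r -mulr_sumr !(big_ord_recl n) /=; by field.
Qed.

Lemma big_enum_seq n (f : 'I_n -> K) (R : Type) (idx : R) (op : R -> R -> R) (g : K -> R) :
  \big[op/idx]_(c <- [seq f i | i <- enum 'I_n]) g c = \big[op/idx]_(i < n) g (f i).
Proof. by rewrite big_map enumT [index_enum _]unlock. Qed.
End PowerSums.

Section MulCoef.
Variables (K : numFieldType) (n : nat) (z m : 'I_n -> K).

Lemma dpolyE : dpoly z = \prod_(c <- [seq z i | i <- enum 'I_n]) ('X - c%:P).
Proof. by rewrite big_enum_seq. Qed.

Lemma apolyE : apoly z m = \prod_(c <- [seq z i - m i | i <- enum 'I_n]) ('X - c%:P).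
Proof.
by rewrite big_enum_seq; apply: eq_bigr => i _; rewrite polyCB opprB addrA addrAC.
Qed.

Lemma size_zs (f : 'I_n -> K) : size [seq f i | i <- enum 'I_n] = n.
Proof. by rewrite size_map size_enum_ord. Qed.

(** The coefficient of u^-i in u^-n d(u); with the zeros beyond n, [mul_coef] becomes an
    unrestricted convolution. *)
Definition dcoef (i : nat) : K := if (i <= n)%N then (dpoly z)`_(n - i) else 0.

Lemma mul_coefE (V : lmodType K) (S : nat -> V) k :
  mul_coef z S k = \sum_(i < k.+1) dcoef i *: S (k - i)%N.
Proof.
rewrite /mul_coef big_mkcond; apply: eq_bigr => i _; rewrite /dcoef.
by case: ifP; rewrite ?scale0r.
Qed.

Lemma dcoef0 : dcoef 0 = 1.
Proof.
rewrite /dcoef subn0 dpolyE.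
by have [_ + _ _] := prod_XsubC_top [seq z i | i <- enum 'I_n]; rewrite size_zs.
Qed.

Lemma dcoef1 : (0 < n)%N -> dcoef 1 = - \sum_i z i.
Proof.
move=> n0; rewrite /dcoef n0 subn1 dpolyE.
have [_ _ + _] := prod_XsubC_top [seq z i | i <- enum 'I_n].
by rewrite size_zs => -> //; congr (- _); apply: (big_enum_seq z 0 +%R id).
Qed.
End MulCoef.

Section LinAlg.
Variables (K : comNzRingType) (V : lmodType K).
Implicit Types f g : {linear V -> V}.
Lemma lin_scaleAl a f g : (a *: f) * g = a *: (f * g).
Proof. by apply: lin_ext. Qed.
Lemma lin_scaleAr a f g : f * (a *: g) = a *: (f * g).
Proof. by apply: lin_ext => x; rewrite -[LHS]/(f (a *: g x)) linearZ. Qed.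
Lemma lin_sumE (I : Type) (r : seq I) (P : pred I) (F : I -> {linear V -> V}) x :
  (\sum_(i <- r | P i) F i) x = \sum_(i <- r | P i) F i x.
Proof. by elim/big_rec2: _ => // i y f _ <-. Qed.
Lemma lin_commP f g : f * g - g * f = 0 -> f * g = g * f.
Proof. by move/eqP; rewrite subr_eq0 => /eqP. Qed.
End LinAlg.

Section Conv.
Variables (K : numFieldType) (n : nat) (z : 'I_n -> K) (V : lmodType K).
Implicit Types S U : nat -> {linear V -> V}.

(** The coefficient of u^(n-k) v^(n-j) in d(u) d(v) times the double series with coefficients
    [B r s] at u^-r v^-s. It carries the Yangian relations over to the series multiplied by d. *)
Definition conv2 (B : nat -> nat -> {linear V -> V}) k j :=
  \sum_(i < k.+1) \sum_(i' < j.+1) (dcoef z i * dcoef z i') *: B (k - i)%N (j - i')%N.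

Lemma mul_coefM S U k j : mul_coef z S k * mul_coef z U j = conv2 (fun r s => S r * U s) k j.
Proof.
rewrite !mul_coefE mulr_suml; apply: eq_bigr => i _; rewrite mulr_sumr.
by apply: eq_bigr => i' _; rewrite lin_scaleAl lin_scaleAr scalerA.
Qed.

Lemma mul_coefMr S U k j : mul_coef z U j * mul_coef z S k = conv2 (fun r s => U s * S r) k j.
Proof.
rewrite mul_coefM /conv2 exchange_big; apply: eq_bigr => i _; apply: eq_bigr => i' _.
by rewrite mulrC.
Qed.

Lemma conv2B B B' k j : conv2 B k j - conv2 B' k j = conv2 (fun r s => B r s - B' r s) k j.
Proof.
rewrite -sumrB; apply: eq_bigr => i _; rewrite -sumrB; apply: eq_bigr => i' _.
by rewrite scalerBr.
Qed.

Lemma conv2_eq B B' k j : (forall r s, B r s = B' r s) -> conv2 B k j = conv2 B' k j.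
Proof. by move=> BB'; apply: eq_bigr => i _; apply: eq_bigr => i' _; rewrite BB'. Qed.

Lemma conv2Z a B k j : conv2 (fun r s => a *: B r s) k j = a *: conv2 B k j.
Proof.
rewrite scaler_sumr; apply: eq_bigr => i _; rewrite scaler_sumr; apply: eq_bigr => i' _.
by rewrite !scalerA mulrC.
Qed.

(** Shifting the first index is multiplication by u; the two sums differ only in terms with r =
    0. *)
Lemma conv2Sl B k j : (forall s, B 0%N s = 0) ->
  conv2 B k.+1 j = conv2 (fun r s => B r.+1 s) k j.
Proof.
move=> B0; rewrite /conv2 big_ord_recr /= [X in _ + X]big1 ?addr0 => [|i _]; last first.
  by rewrite subnn B0 scaler0.
by apply: eq_bigr => i _; apply: eq_bigr => i' _; rewrite subSn // -ltnS.
Qed.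

Lemma conv2Sr B k j : (forall r, B r 0%N = 0) ->
  conv2 B k j.+1 = conv2 (fun r s => B r s.+1) k j.
Proof.
move=> B0; apply: eq_bigr => i _; rewrite big_ord_recr /= subnn B0 scaler0 addr0.
by apply: eq_bigr => i' _; rewrite subSn // -ltnS.
Qed.
End Conv.

(** * Diagonal generators at the zeros of T_12(t) *)

Section PointShift.
Variables (K : numFieldType) (n : nat).
Local Notation W := {mpoly K[n]}.

(** Multiplication by this element is the coefficient of u^(n-k) in d(u) T_12(u). The value 0
    outside the range lets the relations hold for all indices. *)
Definition xvar (k : nat) : W := \sum_(i < n | i.+1 == k) 'X_i.

Lemma xvar_ord (i : 'I_n) : xvar i.+1 = 'X_i.
Proof. by rewrite /xvar (big_pred1 i) // => j; rewrite eqSS. Qed.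

Lemma xvar0 : xvar 0 = 0.
Proof. by rewrite /xvar big_pred0. Qed.

Lemma xvar_gt k : (n < k)%N -> xvar k = 0.
Proof. by move=> nk; rewrite /xvar big_pred0 // => i; rewrite ltn_eqF // (leq_trans _ nk) // ltnS. Qed.

(** W is generated from 1 by multiplications by the x_i, so operators are controlled by their value
    at 1 and their exchange relations with the x_i. *)
Lemma mpoly_mulX_ind (P : W -> Prop) : P 1 -> (forall a p q, P p -> P q -> P (a *: p + q)) ->
  (forall i p, P p -> P ('X_i * p)) -> forall p, P p.
Proof.
move=> P1 Pl PX.
have P0 : P 0 by have := Pl (-1) 1 1 P1 P1; rewrite scaleN1r addNr.
have PM (mon : 'X_{1..n}) : P 'X_[mon].
  suff : forall q : W, P q -> P ('X_[mon] * q) by move/(_ 1 P1); rewrite mulr1.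
  rewrite mpolyXE_id; elim/big_ind: _ => [q|p1 p2 IH1 IH2 q Pq|i _]; first by rewrite mul1r.
    by rewrite -mulrA; apply/IH1/IH2.
  elim: (mon i) => [|e IH] q Pq; first by rewrite mul1r.
  by rewrite exprS -mulrA; apply/PX/IH.
move=> p; rewrite [p]mpolyE; elim/big_rec: _ => // mon q _ Pq.
exact: Pl.
Qed.

Lemma ev_xvar (q : {poly K}) k : (size q <= n)%N -> (k <= n)%N -> ev q (xvar k) = q`_(n - k).
Proof.
case: k => [|k] sq kn; first by rewrite xvar0 raddf0 subn0 nth_default.
by rewrite (xvar_ord (Ordinal kn)) evX -subn1 -subnDA add1n.
Qed.

(** A common setting for d(u) T_11(u), with [eps] = 1 and [c] from a(u), and for d(u) T_22(u), with
    [eps] = -1 and [c] from d(u). *)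
Variables (F : nat -> {linear W -> W}) (c : nat -> K) (eps : K).
Hypothesis F0 : forall v, F 0%N v = v.
Hypothesis F1 : forall k, F k 1 = (c k)%:MP.
Hypothesis c_gt : forall k, (n < k)%N -> c k = 0.
Hypothesis rel : forall k j v, F k.+1 (xvar j * v) - xvar j * F k.+1 v
   - (F k (xvar j.+1 * v) - xvar j.+1 * F k v) = eps *: (xvar k * F j v - xvar j * F k v).

(** The series is a polynomial in u. For k > n the relation expresses F_k(x_(j+1) p) through
    F_(k+1)(x_j p) and terms already known to vanish, and the induction on j starts from x_0 = 0. *)
Lemma series_truncated k v : (n < k)%N -> F k v = 0.
Proof.
move: v k; apply: mpoly_mulX_ind => [k nk|a p q IHp IHq k nk|i p IH k nk].
- by rewrite F1 c_gt // mpolyC0.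
- by rewrite linearP IHp ?IHq // scaler0 addr0.
suff h j : forall k, (n < k)%N -> F k (xvar j * p) = 0 by rewrite -xvar_ord h.
elim: j => [|j IHj] {nk}k nk; first by rewrite xvar0 mul0r linear0.
have := rel k j p; rewrite (xvar_gt nk) IHj ?(leqW nk) // (IH k) ?(IH k.+1) ?(leqW nk) //.
by rewrite ?(mulr0, mul0r, subr0) add0r scaler0 => /eqP; rewrite oppr_eq0 => /eqP.
Qed.

(** The left side [al v] is multiplicative up to its value at 1: multiplying v by x_j multiplies it
    by the j-th coordinate of (t - eps - u) q(u). Hence it is evaluation at this point times
    [al 1]. *)
Lemma point_shift t (q : {poly K}) v : (0 < n)%N -> (size q <= n.-1)%N ->
  \sum_(k < n.+1) t ^+ (n - k) * ev ((t%:P - 'X) * q) (F k v)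
  = (\sum_(k < n.+1) t ^+ (n - k) * c k) * ev (((t - eps)%:P - 'X) * q) v.
Proof.
move=> n_gt0 sq.
have sP a : (size ((a%:P - 'X) * q)%R <= n)%N.
  rewrite -opprB mulNr size_polyN; apply: leq_trans (size_polyMleq _ _) _.
  by rewrite size_XsubC add2n /= -(prednK n_gt0) ltnS.
pose al v := \sum_(k < n.+1) t ^+ (n - k) * ev ((t%:P - 'X) * q) (F k v).
pose e (j : nat) := ev ((t%:P - 'X) * q) (xvar j).
rewrite -[LHS]/(al v).
(* The value of (t - u) q(u) at u = t, that is, the vanishing of T_12(t) at the chosen point. *)
have e_t : \sum_(k < n.+1) t ^+ (n - k) * e k = 0.
  transitivity ((t%:P - 'X) * q).[t]; last by rewrite !hornerE subrr mul0r.
  rewrite (@horner_coef_wide _ n.+1) ?(leq_trans (sP t)) // (reindex_inj rev_ord_inj).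
  apply: eq_bigr => k _; have kn : (k <= n)%N by rewrite -ltnS.
  rewrite /= subSS mulrC /e ev_xvar ?(sP t) ?leq_subr //.
  by rewrite subKn // mulrC.
(* The relation multiplied by t^(n-k) and summed over k; the terms with x_k on its right side cancel
   by [e_t]. *)
have step j p : al (xvar j.+1 * p) = t * al (xvar j * p) + (e j.+1 - (t - eps) * e j) * al p.
  pose C k j := ev ((t%:P - 'X) * q) (F k (xvar j * p)) - e j * ev ((t%:P - 'X) * q) (F k p).
  have sC j' : \sum_(k < n.+1) t ^+ (n - k) * C k j' = al (xvar j' * p) - e j' * al p.
    by rewrite mulr_sumr -sumrB; apply: eq_bigr => k _; rewrite /C mulrBr mulrCA.
  have relC k : C k.+1 j - C k j.+1 =
      eps * (e k * ev ((t%:P - 'X) * q) (F j p) - e j * ev ((t%:P - 'X) * q) (F k p)).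
    have := congr1 (ev ((t%:P - 'X) * q)) (rel k j p).
    by rewrite evZ !raddfB /= !rmorphM /= -/(e j) -/(e k) -/(e j.+1).
  (* The boundary terms vanish: [C 0 j] because F_0 is the identity, [C n.+1 j] by truncation. *)
  have sS : \sum_(k < n.+1) t ^+ (n - k) * C k.+1 j = t * (al (xvar j * p) - e j * al p).
    have Cn : C n.+1 j = 0 by rewrite /C !series_truncated // !raddf0 mulr0 subr0.
    have C0 : C 0 j = 0 by rewrite /C !F0 rmorphM subrr.
    rewrite -sC mulr_sumr [LHS]big_ord_recr [RHS]big_ord_recl /= Cn C0 !mulr0.
    rewrite add0r addr0; apply: eq_bigr => k _.
    by rewrite /bump add1n mulrA -exprS subnSK.
  have := sC j.+1.
  have -> : \sum_(k < n.+1) t ^+ (n - k) * C k j.+1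
     = \sum_(k < n.+1) t ^+ (n - k) * C k.+1 j - \sum_(k < n.+1) t ^+ (n - k) * (C k.+1 j - C k j.+1).
    by rewrite -sumrB; apply: eq_bigr => k _; ring.
  rewrite sS.
  have -> : \sum_(k < n.+1) t ^+ (n - k) * (C k.+1 j - C k j.+1) = - eps * e j * al p.
    under eq_bigr do rewrite relC.
    transitivity (eps * ((\sum_(k < n.+1) t ^+ (n - k) * e k) * ev ((t%:P - 'X) * q) (F j p)
      - e j * al p)); last first.
      by rewrite e_t; ring.
    rewrite mulr_suml /al mulr_sumr -sumrB mulr_sumr; apply: eq_bigr => k _; ring.
  move/eqP; rewrite eq_sym subr_eq => /eqP ->; ring.
have ee a (i : nat) : ((a%:P - 'X) * q)`_i = a * q`_i - ('X * q)`_i.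
  by rewrite mulrBl coefB coefCM.
(* The coordinates of the shifted point satisfy the same recurrence in j, with the same start 0. *)
have main j p : (j <= n)%N -> al (xvar j * p) = ev (((t - eps)%:P - 'X) * q) (xvar j) * al p.
  elim: j => [|j IH] jn.
    rewrite xvar0 mul0r raddf0 mul0r /al big1 // => k _.
    by rewrite linear0 raddf0 mulr0.
  rewrite step IH ?(ltnW jn) // /e !ev_xvar ?(ltnW jn) // !ee !coefXM.
  have -> : (n - j)%N = (n - j.+1).+1 by rewrite -subSn.
  rewrite /=; ring.
move: v; apply: mpoly_mulX_ind => [|a p1 p2 IH1 IH2|i p IH].
- rewrite rmorph1 mulr1; apply: eq_bigr => k _; by rewrite F1 evC.
- rewrite raddfD /= evZ mulrDr mulrCA -IH1 -IH2 /al mulr_sumr -big_split.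
  by apply: eq_bigr => k _ /=; rewrite linearP raddfD /= evZ; ring.
- by rewrite -xvar_ord main // rmorphM /= IH; ring.
Qed.
End PointShift.

Section Transfer.
Variables (K : numFieldType) (n : nat) (z m : 'I_n -> K) (T : holomorphic_rep z m).
Local Notation W := {mpoly K[n]}.

Lemma mul_coef_app (S : nat -> {linear W -> W}) k v :
  mul_coef z S k v = mul_coef z (fun s => S s v) k.
Proof. by rewrite !mul_coefE lin_sumE. Qed.

Lemma mul_coef_bracket (S U : nat -> {linear W -> W}) k j :
  mul_coef z S k * mul_coef z U j - mul_coef z U j * mul_coef z S k
  = conv2 z (fun r s => S r * U s - U s * S r) k j.
Proof. by rewrite mul_coefM (mul_coefMr _ S U k j) conv2B. Qed.

Lemma mul_coef_cross (S U : nat -> {linear W -> W}) k j :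
  mul_coef z S k * mul_coef z U j - mul_coef z S j * mul_coef z U k
  = conv2 z (fun r s => S r * U s - S s * U r) k j.
Proof. by rewrite mul_coefM (mul_coefMr _ U S k j) conv2B. Qed.

Lemma mul_coef_crossr (S U : nat -> {linear W -> W}) k j :
  mul_coef z S j * mul_coef z U k - mul_coef z S k * mul_coef z U j
  = conv2 z (fun r s => S s * U r - S r * U s) k j.
Proof.
rewrite -opprB mul_coef_cross -[LHS]scaleN1r -conv2Z.
by apply: conv2_eq => r s; rewrite scaleN1r opprB.
Qed.

Definition A11 k : {linear W -> W} := mul_coef z (T i1 i1) k.
Definition A12 k : {linear W -> W} := mul_coef z (T i1 i2) k.
Definition A22 k : {linear W -> W} := mul_coef z (T i2 i2) k.

Lemma A12E k v : A12 k v = xvar K n k * v.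
Proof. by rewrite /A12 mul_coef_app hT12 mulr_suml. Qed.

Lemma HtildeE k : Htilde T k = A11 k + A22 k.
Proof.
rewrite /Htilde /A11 /A22 !mul_coefE -big_split; apply: eq_bigr => i _.
by rewrite scalerDr.
Qed.

Lemma T_comm0 a b (f : {linear W -> W}) : T a b 0%N * f - f * T a b 0%N = 0.
Proof.
by have [-> _] := hT_yangian T; rewrite mulr_natl mulr_natr subrr.
Qed.

Lemma T_0 a : T a a 0%N = 1.
Proof. by have [-> _] := hT_yangian T; rewrite eqxx. Qed.

(** The relation is used with T_12 as first factor of the bracket, which puts T_12, a
    multiplication, on the left of both products on the right side. *)
Lemma T11_T12 r s : T i1 i1 r.+1 * T i1 i2 s - T i1 i2 s * T i1 i1 r.+1
   - (T i1 i1 r * T i1 i2 s.+1 - T i1 i2 s.+1 * T i1 i1 r)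
  = T i1 i2 r * T i1 i1 s - T i1 i2 s * T i1 i1 r.
Proof.
have [_ /(_ i1 i2 i1 i1 s r) <-] := hT_yangian T.
by rewrite opprB [RHS]addrC opprB.
Qed.

Lemma T22_T12 r s : T i2 i2 r.+1 * T i1 i2 s - T i1 i2 s * T i2 i2 r.+1
   - (T i2 i2 r * T i1 i2 s.+1 - T i1 i2 s.+1 * T i2 i2 r)
  = T i1 i2 s * T i2 i2 r - T i1 i2 r * T i2 i2 s.
Proof. by have [_ /(_ i2 i2 i1 i2 r s)] := hT_yangian T. Qed.

(** The relation times d(u) d(v). Brackets with a T^{0} vanish, so the factors u and v act as index
    shifts. *)
Lemma A11_rel k j v : A11 k.+1 (xvar K n j * v) - xvar K n j * A11 k.+1 v
   - (A11 k (xvar K n j.+1 * v) - xvar K n j.+1 * A11 k v)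
   = 1 *: (xvar K n k * A11 j v - xvar K n j * A11 k v).
Proof.
suff : A11 k.+1 * A12 j - A12 j * A11 k.+1 - (A11 k * A12 j.+1 - A12 j.+1 * A11 k)
    = A12 k * A11 j - A12 j * A11 k.
  by move/(congr1 (fun f : {linear W -> W} => f v)); rewrite scale1r /= -!A12E.
rewrite !(mul_coef_bracket (T i1 i1) (T i1 i2)) (mul_coef_cross (T i1 i2) (T i1 i1)).
rewrite conv2Sl ?conv2Sr ?conv2B; last 2 first.
- by move=> r; rewrite -opprB T_comm0 oppr0.
- by move=> s; rewrite T_comm0.
by apply: conv2_eq => r s; rewrite T11_T12.
Qed.

Lemma A22_rel k j v : A22 k.+1 (xvar K n j * v) - xvar K n j * A22 k.+1 v
   - (A22 k (xvar K n j.+1 * v) - xvar K n j.+1 * A22 k v)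
   = (-1) *: (xvar K n k * A22 j v - xvar K n j * A22 k v).
Proof.
suff : A22 k.+1 * A12 j - A12 j * A22 k.+1 - (A22 k * A12 j.+1 - A12 j.+1 * A22 k)
    = - (A12 k * A22 j - A12 j * A22 k).
  by move/(congr1 (fun f : {linear W -> W} => f v)); rewrite scaleN1r /= -!A12E.
rewrite [RHS]opprB !(mul_coef_bracket (T i2 i2) (T i1 i2)).
rewrite (mul_coef_crossr (T i1 i2) (T i2 i2)) conv2Sl ?conv2Sr ?conv2B; last 2 first.
- by move=> r; rewrite -opprB T_comm0 oppr0.
- by move=> s; rewrite T_comm0.
by apply: conv2_eq => r s; rewrite T22_T12.
Qed.

Definition acoef (p : {poly K}) k := if (k <= n)%N then p`_(n - k) else 0.

Lemma sum_acoef (p : {poly K}) t : (size p <= n.+1)%N ->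
  \sum_(k < n.+1) t ^+ (n - k) * acoef p k = p.[t].
Proof.
move=> sp; rewrite (@horner_coef_wide _ n.+1) // (reindex_inj rev_ord_inj).
apply: eq_bigr => k _; have kn : (k <= n)%N by rewrite -ltnS.
by rewrite /= subSS /acoef leq_subr (subKn kn) mulrC.
Qed.

Lemma size_adpoly (f : 'I_n -> K) :
  size (\prod_(c <- [seq f i | i <- enum 'I_n]) ('X - c%:P)) = n.+1.
Proof. by rewrite size_prod_XsubC size_zs. Qed.

Lemma mul_coef0 (V : lmodType K) (S : nat -> V) : mul_coef z S 0 = S 0%N.
Proof. by rewrite mul_coefE big_ord1 dcoef0 scale1r. Qed.

Lemma A11_1 k : A11 k 1 = (acoef (apoly z m) k)%:MP.
Proof. by rewrite /A11 mul_coef_app hT11. Qed.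

Lemma A22_1 k : A22 k 1 = (acoef (dpoly z) k)%:MP.
Proof.
rewrite /A22 mul_coef_app mul_coefE big_ord_recr /= subnn hT22 big1 ?add0r.
  by rewrite -[acoef _ _]/(dcoef z k) -mul_mpolyC mulr1.
by move=> i _; rewrite hT22 subn_eq0 leqNgt ltn_ord /= mulr0n scaler0.
Qed.

Lemma acoef_gt (p : {poly K}) k : (n < k)%N -> acoef p k = 0.
Proof. by move=> nk; rewrite /acoef leqNgt nk. Qed.

Lemma A11_0 v : A11 0 v = v.
Proof. by rewrite /A11 mul_coef0 T_0. Qed.

Lemma A22_0 v : A22 0 v = v.
Proof. by rewrite /A22 mul_coef0 T_0. Qed.

(* Baxter's equation: at the points x(u) = (t - u) q(u), i.e. where T_12(t)
   vanishes, T_11(t) and T_22(t) act by shifting t. *)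
Lemma Htilde_point t (q : {poly K}) v : (0 < n)%N -> (size q <= n.-1)%N ->
  \sum_(k < n.+1) t ^+ (n - k) * ev ((t%:P - 'X) * q) (Htilde T k v)
  = (dpoly z).[t] * ev (((t + 1)%:P - 'X) * q) v
    + (apoly z m).[t] * ev (((t - 1)%:P - 'X) * q) v.
Proof.
move=> n_gt0 sq.
have h11 := point_shift A11_0 A11_1 (fun k => @acoef_gt _ k) A11_rel t v n_gt0 sq.
have h22 := point_shift A22_0 A22_1 (fun k => @acoef_gt _ k) A22_rel t v n_gt0 sq.
rewrite sum_acoef ?apolyE ?size_adpoly // in h11.
rewrite sum_acoef ?dpolyE ?size_adpoly // opprK in h22.
rewrite dpolyE apolyE -h11 -h22 [RHS]addrC -big_split; apply: eq_bigr => k _ /=.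
by rewrite HtildeE linDE raddfD /= mulrDr.
Qed.

Lemma T11_comm r s : T i1 i1 r * T i1 i1 s = T i1 i1 s * T i1 i1 r.
Proof.
apply: lin_commP; elim: r s => [|r IH] s; first exact: T_comm0.
have [_ /(_ i1 i1 i1 i1 r s)] := hT_yangian T.
by rewrite IH subr0 => ->; rewrite -opprB IH oppr0.
Qed.

Lemma T22_comm r s : T i2 i2 r * T i2 i2 s = T i2 i2 s * T i2 i2 r.
Proof.
apply: lin_commP; elim: r s => [|r IH] s; first exact: T_comm0.
have [_ /(_ i2 i2 i2 i2 r s)] := hT_yangian T.
by rewrite IH subr0 => ->; rewrite -opprB IH oppr0.
Qed.

(** This symmetry in r and s makes the mixed brackets cancel in the commutator of two transfer
    matrix coefficients. *)
Lemma T11_T22 r s : T i1 i1 r * T i2 i2 s - T i2 i2 s * T i1 i1 r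
  = T i1 i1 s * T i2 i2 r - T i2 i2 r * T i1 i1 s.
Proof.
elim: r s => [|r IH] s.
  by rewrite T_comm0 -opprB T_comm0 oppr0.
have [_ Y] := hT_yangian T.
have /eqP := Y i1 i1 i2 i2 r s; rewrite subr_eq => /eqP ->.
have /eqP := Y i1 i1 i2 i2 s r; rewrite subr_eq IH => /eqP ->.
by rewrite addrA -[X in X + _ + _]opprB addNr add0r.
Qed.

Lemma Htilde_comm k j : Htilde T k * Htilde T j = Htilde T j * Htilde T k.
Proof.
apply: lin_commP; rewrite mul_coef_bracket /conv2 big1 // => i _; rewrite big1 // => i' _.
set r := (k - i)%N; set s := (j - i')%N.
have -> : (T i1 i1 r + T i2 i2 r) * (T i1 i1 s + T i2 i2 s)
   - (T i1 i1 s + T i2 i2 s) * (T i1 i1 r + T i2 i2 r) = 0; last by rewrite scaler0.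
rewrite !mulrDl !mulrDr [T i1 i1 s * T i1 i1 r]T11_comm [T i2 i2 s * T i2 i2 r]T22_comm.
have /eqP := T11_T22 r s; rewrite subr_eq => /eqP ->.
apply/eqP; rewrite subr_eq0; apply/eqP; rewrite -!addrA; do 2 congr (_ + _).
by rewrite [X in - _ + X]addrCA addKr.
Qed.

Lemma Htilde0 v : Htilde T 0 v = 2 *: v.
Proof. by rewrite HtildeE linDE A11_0 A22_0 -[v in LHS]scale1r -scalerDl -mulr2n. Qed.

Lemma T12_1 v : (0 < n)%N -> T i1 i2 1%N v = xvar K n 1 * v.
Proof.
move=> n_gt0; rewrite -A12E /A12 mul_coefE big_ord_recl big_ord1 /= dcoef0 scale1r subn0.
have [-> _] := hT_yangian T.
by rewrite [_%:R](_ : _ = 0 :> {linear W -> W}) // scaler0 addr0.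
Qed.
End Transfer.

(** * The Casimir element and the scalars in H_1 and H_2 *)

Section Casimir.
Variables (K : numFieldType) (n : nat) (z m : 'I_n -> K) (T : holomorphic_rep z m).
Hypothesis n_ge2 : (2 <= n)%N.
Local Notation W := {mpoly K[n]}.

(** T_12 generates W from 1, so an operator commuting with T_12 is determined by its value at 1. *)
Lemma central_scalar (C : {linear W -> W}) c :
  (forall s v, C (T i1 i2 s v) = T i1 i2 s (C v)) -> C 1 = c%:MP ->
  forall v, C v = c *: v.
Proof.
move=> comC C1; apply: mpoly_mulX_ind => [|a p q IHp IHq|i p IH].
- by rewrite C1 -mul_mpolyC mulr1.
- by rewrite linearP IHp IHq scalerDr !scalerA mulrC.
rewrite -xvar_ord -!(A12E T) /A12 !mul_coef_app !mul_coefE linear_sum /= scaler_sumr.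
by apply: eq_bigr => j _; rewrite linearZ /= comC IH linearZ /= !scalerA mulrC.
Qed.

Let M := \sum_i m i.
Let Z := \sum_i z i.

Lemma lin1E (V : lmodType K) (v : V) : (1 : {linear V -> V}) v = v.
Proof. by []. Qed.

Lemma T1_commE a b c d s v : T a b 1%N (T c d s v) = T c d s (T a b 1%N v)
  + (T c b s v *+ (a == d) - T a d s v *+ (c == b)).
Proof.
have /(congr1 (fun f : {linear W -> W} => f v)) := T1_comm T a b c d s.
rewrite linDE linNE !linME => /eqP; rewrite subr_eq addrC => /eqP ->.
by congr (_ + _); case: (a == d); case: (c == b); rewrite ?mulr1n ?mulr0n ?subr0.
Qed.

Lemma acoef1 : acoef n (apoly z m) 1 = M - Z.
Proof.
rewrite /acoef (ltnW n_ge2) subn1 apolyE.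
have [_ _ + _] := prod_XsubC_top [seq z i - m i | i <- enum 'I_n].
rewrite (@size_zs _ n (fun i => z i - m i)) => -> //; last exact: ltnW.
by rewrite (big_enum_seq (fun i => z i - m i) 0 +%R id) sumrB opprB.
Qed.

Lemma T11_1_1 : T i1 i1 1%N 1 = M%:MP.
Proof.
have := A11_1 T 1; rewrite /A11 mul_coef_app mul_coefE big_ord_recl big_ord1 /=.
rewrite dcoef0 scale1r acoef1 dcoef1 ?(ltnW n_ge2) // T_0 -[X in _ + X]mul_mpolyC mulr1.
by rewrite mpolyCN mpolyCB => /addIr.
Qed.

Lemma e_central v : T i1 i1 1%N v + T i2 i2 1%N v = M *: v.
Proof.
rewrite -linDE; move: v; apply: central_scalar => [s v|].
  rewrite !linDE !T1_commE linearD /= !mulr1n !mulr0n; ring.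
by rewrite linDE T11_1_1 hT22 addr0.
Qed.

Lemma T12_comm r s v : T i1 i2 r (T i1 i2 s v) = T i1 i2 s (T i1 i2 r v).
Proof.
suff /lin_commP /(congr1 (fun f : {linear W -> W} => f v)) :
  T i1 i2 r * T i1 i2 s - T i1 i2 s * T i1 i2 r = 0 by [].
elim: r s => [|r IH] s; first exact: T_comm0.
have [_ /(_ i1 i2 i1 i2 r s)] := hT_yangian T.
by rewrite IH subr0 => ->; rewrite -opprB IH oppr0.
Qed.

Lemma e_T11 v : T i1 i1 1%N v = M *: v - T i2 i2 1%N v.
Proof. by rewrite -e_central addrK. Qed.

(** The coefficient of u^-2 in a(u) / d(u). *)
Definition casimir_const := acoef n (apoly z m) 2 - dcoef z 1 * M - dcoef z 2.

Lemma T11_2_1 : T i1 i1 2%N 1 = casimir_const%:MP.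
Proof.
have := A11_1 T 2; rewrite /A11 mul_coef_app mul_coefE 2!big_ord_recl big_ord1 /=.
rewrite dcoef0 scale1r T11_1_1 T_0 /casimir_const !mpolyCB => <-.
rewrite -!mul_mpolyC mulr1 mpolyCM /=; ring.
Qed.

(** The operator is the u^-2 coefficient of the quantum determinant T_11(u) T_22(u-1) - T_12(u)
    T_21(u-1), with e_11 replaced by M - e_22. It commutes with T_12, so its value at 1 decides. *)
Lemma casimir v : T i1 i1 2%N v + T i2 i2 2%N v - T i1 i2 1%N (T i2 i1 1%N v)
  + M *: T i2 i2 1%N v - T i2 i2 1%N (T i2 i2 1%N v) + T i2 i2 1%N v = casimir_const *: v.
Proof.
have [G GE] : exists G : {linear W -> W}, forall u, G u = T i1 i1 2%N u + T i2 i2 2%N u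
  - T i1 i2 1%N (T i2 i1 1%N u) + M *: T i2 i2 1%N u - T i2 i2 1%N (T i2 i2 1%N u)
  + T i2 i2 1%N u.
  by exists (T i1 i1 2%N + T i2 i2 2%N - T i1 i2 1%N * T i2 i1 1%N
    + M *: T i2 i2 1%N - T i2 i2 1%N * T i2 i2 1%N + T i2 i2 1%N).
rewrite -GE; move: v; apply: central_scalar => [s v|]; last first.
  by rewrite GE T11_2_1 !hT22 hT21 /= !mulr0n !linear0 ?(scaler0, addr0, subr0).
have r1 : T i1 i1 2%N (T i1 i2 s v) = T i1 i2 s (T i1 i1 2%N v)
    + (T i1 i1 1%N (T i1 i2 s.+1 v) - T i1 i2 s.+1 (T i1 i1 1%N v))
    + (T i1 i2 1%N (T i1 i1 s v) - T i1 i2 s (T i1 i1 1%N v)).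
  have /= := congr1 (fun f : {linear W -> W} => f v) (T11_T12 T 1 s).
  by rewrite ?(linDE, linNE, linME) /= => <-; ring.
have r2 : T i2 i2 2%N (T i1 i2 s v) = T i1 i2 s (T i2 i2 2%N v)
    + (T i2 i2 1%N (T i1 i2 s.+1 v) - T i1 i2 s.+1 (T i2 i2 1%N v))
    + (T i1 i2 s (T i2 i2 1%N v) - T i1 i2 1%N (T i2 i2 s v)).
  have /= := congr1 (fun f : {linear W -> W} => f v) (T22_T12 T 1 s).
  by rewrite ?(linDE, linNE, linME) /= => <-; ring.
have EX k u : T i2 i2 1%N (T i1 i2 k u) = T i1 i2 k (T i2 i2 1%N u) + T i1 i2 k u.
  by rewrite T1_commE /= mulr1n mulr0n subr0.
have FX u : T i2 i1 1%N (T i1 i2 s u) = T i1 i2 s (T i2 i1 1%N u) + (T i1 i1 s u - T i2 i2 s u).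
  by rewrite T1_commE /= !mulr1n.
rewrite !GE r1 r2 !e_T11 !EX FX !linearD !linearN /= !EX !linearD !linearN /=.
rewrite (T12_comm 1 s) !linearZ /= -!mul_mpolyC. ring.
Qed.

(* The quadratic transfer matrix coefficient is the Casimir element up to
   e_21 e_12, and e_21 is multiplication by x_1. *)
Lemma Htilde2 l v : v \is l.-homog -> Htilde T 2 v = xvar K n 1 * T i2 i1 1%N v
  + (l%:R * (l%:R - 1 - M) + acoef n (apoly z m) 2 + dcoef z 2) *: v.
Proof.
move=> hv; have hE := e22_hom T hv.
have := casimir v; rewrite hE [T i2 i2 1%N (_ *: _)]linearZ /= hE => C.
rewrite /Htilde mul_coef_app mul_coefE 2!big_ord_recl big_ord1 /=.
rewrite dcoef0 scale1r e_central !T_0 -(T12_1 T) ?(ltnW n_ge2) //.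
have -> : T i1 i1 2%N v + T i2 i2 2%N v = casimir_const *: v + T i1 i2 1%N (T i2 i1 1%N v)
   - M *: (l%:R *: v) + l%:R *: (l%:R *: v) - l%:R *: v by rewrite -C; ring.
rewrite -!mul_mpolyC /casimir_const !(mpolyCD, mpolyCB, mpolyCM, mpolyC1).
rewrite lin1E; ring.
Qed.

Lemma Htilde1 v : Htilde T 1 v = (\sum_i (m i - 2 * z i)) *: v.
Proof.
rewrite /Htilde mul_coef_app mul_coefE big_ord_recl big_ord1 /=.
rewrite dcoef0 scale1r e_central !T_0 dcoef1 ?(ltnW n_ge2) //.
rewrite sumrB -mulr_sumr -/M -/Z.
rewrite -!mul_mpolyC !(mpolyCD, mpolyCB, mpolyCM, mpolyCN).
by rewrite lin1E; ring.
Qed.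

Lemma acoef2 : acoef n (apoly z m) 2 + dcoef z 2
  = \sum_(i < n) \sum_(j < n | (i < j)%N) (z i * z j + (z i - m i) * (z j - m j)).
Proof.
under eq_bigr do rewrite big_split; rewrite big_split /= addrC.
rewrite (sum_ltn_mul z) (sum_ltn_mul (fun i => z i - m i)) /acoef /dcoef n_ge2 subn2 dpolyE apolyE.
have [_ _ _] := prod_XsubC_top [seq z i | i <- enum 'I_n].
have [_ _ _] := prod_XsubC_top [seq z i - m i | i <- enum 'I_n].
rewrite !size_zs => /(_ n_ge2) -> /(_ n_ge2) ->.
rewrite (big_enum_seq z 0 +%R id) (big_enum_seq (fun i => z i - m i) 0 +%R id).
rewrite (big_enum_seq z 0 +%R (fun c => c ^+ 2)).
by rewrite (big_enum_seq (fun i => z i - m i) 0 +%R (fun c => c ^+ 2)).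
Qed.
End Casimir.

(** * The algebra A_D *)

Section Indicial.
Variable K : numFieldType.

Lemma prod_XsubC_exp_top (s : seq K) (c : K) (r : nat)
    (p := \prod_(x <- s) ('X - x%:P) * ('X - c%:P) ^+ r) (N := (size s + r)%N)
    (e1 := \sum_(x <- s) x + r%:R * c) (e2 := \sum_(x <- s) x ^+ 2 + r%:R * c ^+ 2) :
  [/\ forall j, (N < j)%N -> p`_j = 0, p`_N = 1, (0 < N)%N -> p`_N.-1 = - e1 &
      (1 < N)%N -> p`_N.-2 = (e1 ^+ 2 - e2) / 2].
Proof.
have nseqE (R : pzRingType) (f : K -> R) : \sum_(x <- nseq r c) f x = r%:R * f c.
  by rewrite big_nseq -Monoid.iteropE mulr_natl.
have := prod_XsubC_top (s ++ nseq r c).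
rewrite !big_cat /= big_nseq -Monoid.iteropE /= !nseqE size_cat size_nseq.
case=> sp p0 p1 p2; split=> // j Nj; by rewrite nth_default // sp.
Qed.

Variables (n l : nat) (z m : 'I_n -> K).
Hypothesis n_ge2 : (2 <= n)%N.

(** The scalars by which H_0, H_1, H_2 act on singular vectors and to which 2, h_1, h_2 reduce
    modulo I_D; the last branch is meant for k = 2. *)
Definition kappa k : K := match k with
  | 0 => 2
  | 1 => \sum_i (m i - 2 * z i)
  | _ => l%:R * (l%:R - 1 - \sum_i m i)
    + \sum_(i < n) \sum_(j < n | (i < j)%N) (z i * z j + (z i - m i) * (z j - m j))
  end.

(** Baxter's operator applied to u^r: the two highest powers cancel, and the next one carries the
    indicial polynomial. At r = l - s its value is s (sum_i m_i - 2 l + 1 + s). *)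
Lemma kappa_coef r (p1 := dpoly z * 'X^r) (p2 := apoly z m * ('X - 2%:P) ^+ r)
    (p := fun k => 'X^(n - k) * ('X - 1%:P) ^+ r)
    (D := p1 + p2 - \sum_(k < 3) kappa k *: p k) :
  (forall j, (n - 2 + r < j)%N -> D`_j = 0) /\
  D`_(n - 2 + r) = r%:R * (r%:R - 1 - \sum_i m i) - l%:R * (l%:R - 1 - \sum_i m i).
Proof.
have two : (2 : K) != 0 by rewrite pnatr_eq0.
have DE j : D`_j = p1`_j + p2`_j - (kappa 0 * (p 0)`_j + kappa 1 * (p 1)`_j + kappa 2 * (p 2)`_j).
  by rewrite /D !big_ord_recr big_ord0 /= add0r !coefE.
have p1E : p1 = \prod_(x <- [seq z i | i <- enum 'I_n]) ('X - x%:P) * ('X - 0%:P) ^+ r.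
  by rewrite /p1 dpolyE subr0.
have p2E : p2 = \prod_(x <- [seq z i - m i | i <- enum 'I_n]) ('X - x%:P) * ('X - 2%:P) ^+ r.
  by rewrite /p2 apolyE.
have pE k : p k = \prod_(x <- nseq (n - k) 0) ('X - x%:P) * ('X - 1%:P) ^+ r.
  by rewrite /p big_nseq -Monoid.iteropE subr0.
have [] := prod_XsubC_exp_top [seq z i | i <- enum 'I_n] 0 r.
rewrite -p1E size_zs (big_enum_seq z 0 +%R id) (big_enum_seq z 0 +%R (fun x => x ^+ 2)).
move=> d3 d2 d1 d0.
have [] := prod_XsubC_exp_top [seq z i - m i | i <- enum 'I_n] 2 r.
rewrite -p2E size_zs (big_enum_seq (fun i => z i - m i) 0 +%R id).
rewrite (big_enum_seq (fun i => z i - m i) 0 +%R (fun x => x ^+ 2)).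
move=> a3 a2 a1 a0.
have pT k : [/\ forall j, (n - k + r < j)%N -> (p k)`_j = 0, (p k)`_(n - k + r) = 1,
    (0 < n - k + r)%N -> (p k)`_(n - k + r).-1 = - r%:R &
    (1 < n - k + r)%N -> (p k)`_(n - k + r).-2 = (r%:R ^+ 2 - r%:R) / 2].
  have [] := prod_XsubC_exp_top (nseq (n - k) 0) 1 r.
  rewrite -pE size_nseq !big1_seq => [|x|x]; last 2 first.
  - by move=> /andP[_ /nseqP[-> _]]; rewrite expr0n.
  - by move=> /andP[_ /nseqP[-> _]].
  by rewrite !add0r expr1n !mulr1.
have [p03 p02 p01 p00] := pT 0%N; have [p13 p12 p11 _] := pT 1%N; have [p23 p22 _ _] := pT 2%N.
have k1 : \sum_i (m i - 2 * z i) = - (\sum_i z i + \sum_i (z i - m i)).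
  by rewrite -big_split -sumrN; apply: eq_bigr => i _ /=; ring.
have nr : (1 < n + r)%N by rewrite ltn_addr.
have nr0 : (0 < n + r)%N by apply: ltnW.
have e1 : (n - 1 + r = (n + r).-1)%N by rewrite addnC addnBA ?(ltnW n_ge2) // subn1 addnC.
have e2 : (n - 2 + r = (n + r).-2)%N by rewrite addnC addnBA // subn2 addnC.
rewrite subn0 in p03 p02 p01 p00; rewrite e1 in p13 p12 p11; rewrite e2 in p23 p22 *.
move: d1 d0 a1 a0 p01 p00 p11 => /(_ nr0) d1 /(_ nr) d0 /(_ nr0) a1 /(_ nr) a0 /(_ nr0) p01 /(_ nr) p00.
have {}e1 : (0 < (n + r).-1)%N by case: (n + r)%N nr => [|[]].
move=> /(_ e1) p11; split=> [j|]; rewrite DE; last first.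
  rewrite d0 a0 p00 p11 p22 /kappa /=.
  have -> : \sum_(i < n) \sum_(j < n | (i < j)%N) (z i * z j + (z i - m i) * (z j - m j))
    = ((\sum_i z i) ^+ 2 - \sum_i z i ^+ 2) / 2
      + ((\sum_i (z i - m i)) ^+ 2 - \sum_i (z i - m i) ^+ 2) / 2.
    rewrite -(sum_ltn_mul z) -(sum_ltn_mul (fun i => z i - m i)) -big_split.
    by apply: eq_bigr => i _; rewrite -big_split.
  rewrite k1.
  have -> : \sum_i m i = \sum_i z i - \sum_i (z i - m i).
    by rewrite -sumrB; apply: eq_bigr => i _; ring.
  by field.
have [N NE] : exists N, (n + r = N.+2)%N.
  by exists (n + r).-2; case: (n + r)%N nr => [|[]].
rewrite NE /= in d3 d2 d1 a3 a2 a1 p03 p02 p01 p13 p12 p11 p23 *.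
rewrite leq_eqVlt => /orP[/eqP <-|].
  by rewrite d1 a1 p01 p12 p23 // /kappa k1; ring.
rewrite leq_eqVlt => /orP[/eqP <-|Nj].
  by rewrite d2 a2 p02 p13 // p23 // /kappa; ring.
rewrite d3 ?a3 ?p03 ?p13 ?p23 // ?(ltnW Nj) // ?(ltnW (ltnW Nj)) //.
by rewrite !mulr0 !addr0 subr0.
Qed.
End Indicial.

Section Baxter.
Variables (K : numFieldType) (n l : nat) (z m : 'I_n -> K).
Hypothesis n_ge2 : (2 <= n)%N.

Section Term.
Variables (V : lmodType K) (w : nat -> V) (y : nat -> nat -> V).

(* The contribution of u^(l-s) to the coefficient of u^j in Baxter's equation for
   sum_s w_s u^(l-s), where y k s stands for h_k w_s. *)
Definition baxter_term s j : V :=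
  (dpoly z * 'X^(l - s) + apoly z m * ('X - 2%:P) ^+ (l - s))`_j *: w s
  - \sum_(k < n.+1) ('X^(n - k) * ('X - 1%:P) ^+ (l - s))`_j *: y k s.

(** The h_k with k >= 3 contribute only below degree n - 2 + (l - s), so this coefficient is decided
    by [kappa]. Baxter's equation is thus triangular: its coefficient of degree n - 2 + (l - s)
    involves no w_s' with s' > s. *)
Lemma baxter_term_top s : (s <= l)%N ->
  (forall k, (k < 3)%N -> y k s = kappa l z m k *: w s) ->
  (forall j, (n - 2 + (l - s) < j)%N -> baxter_term s j = 0) /\
  baxter_term s (n - 2 + (l - s))
    = (s%:R * (\sum_i m i - 2 * l%:R + 1 + s%:R)) *: w s.
Proof.
move=> sl yk.
have [D0 Dtop] := kappa_coef l z m n_ge2 (l - s).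
have bE j : (n - 2 + (l - s) <= j)%N -> baxter_term s j
   = (dpoly z * 'X^(l - s) + apoly z m * ('X - 2%:P) ^+ (l - s)
       - \sum_(k < 3) kappa l z m k *: ('X^(n - k) * ('X - 1%:P) ^+ (l - s)))`_j *: w s.
  move=> le_j; rewrite coefB [RHS]scalerBl; congr (_ - _).
  rewrite coef_sum scaler_suml (big_ord_widen n.+1 (fun k : nat =>
    (kappa l z m k *: ('X^(n - k) * ('X - 1%:P) ^+ (l - s)))`_j *: w s)) //.
  rewrite [RHS]big_mkcond; apply: eq_bigr => k _; case: ltnP => k3.
    by rewrite yk // scalerA coefZ mulrC.
  rewrite nth_default ?scale0r //.
  apply: leq_trans (size_polyMleq _ _) _; rewrite size_polyXn.
  rewrite (_ : ('X - 1%:P) ^+ (l - s) = \prod_(x <- nseq (l - s) 1) ('X - x%:P)); last first.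
    by rewrite big_nseq -Monoid.iteropE.
  rewrite size_prod_XsubC size_nseq addSn addnS /= -addSn.
  apply: leq_trans le_j; rewrite leq_add2r.
  by rewrite ltn_sub2l // (leq_trans k3) // -ltnS.
split=> [j lt_j|]; first by rewrite bE ?(ltnW lt_j) // D0 // scale0r.
by rewrite bE // Dtop; congr (_ *: _); rewrite natrB //; ring.
Qed.
End Term.

Local Notation S := {mpoly K[l + n]}.
Definition ahat s : S := if s is 0 then 1 else avar K n l s.
Definition hhat k : S := if k is 0 then 2 else hvar K n l k.

Lemma ppolyE : ppoly K n l = \sum_(s < l.+1) (ahat s)%:P * 'X^(l - s).
Proof.
rewrite big_ord_recl /= subn0 mul1r /ppoly; congr (_ + _).
by rewrite big_add1 /= big_mkord; apply: eq_bigr.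
Qed.

Lemma BpolyE : Bpoly K n l = \sum_(k < n.+1) (hhat k)%:P * 'X^(n - k).
Proof.
rewrite big_ord_recl /= subn0 /Bpoly; congr (_ + _).
by rewrite big_add1 /= big_mkord; apply: eq_bigr.
Qed.

Lemma ppoly_shift (c : K) (c' : S) : c' = c%:MP -> ppoly K n l \Po ('X - c'%:P)
  = \sum_(s < l.+1) (ahat s)%:P * map_poly (@mpolyC _ K) (('X - c%:P) ^+ (l - s)).
Proof.
move=> ->; rewrite ppolyE rmorph_sum; apply: eq_bigr => s _.
by rewrite rmorphM /= comp_polyC comp_Xn_poly rmorphXn /= rmorphB /= map_polyX map_polyC.
Qed.

(** A general [phi] serves both the projection to A_D and the functionals that evaluate an action of
    C[a,h] on a singular vector. *)
Lemma Dpoly_coef (V : lmodType K) (phi : {linear S -> V}) j :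
  phi (Dpoly l z m)`_j = \sum_(s < l.+1)
    baxter_term (fun s => phi (ahat s)) (fun k s => phi (hhat k * ahat s)) s j.
Proof.
have DE : Dpoly l z m = \sum_(s < l.+1) ((ahat s)%:P * map_poly (@mpolyC _ K)
     (dpoly z * 'X^(l - s) + apoly z m * ('X - 2%:P) ^+ (l - s))
   - \sum_(k < n.+1) (hhat k * ahat s)%:P *
        map_poly (@mpolyC _ K) ('X^(n - k) * ('X - 1%:P) ^+ (l - s))).
  have c2 : 2 = 2%:MP :> S by rewrite -[2]/(1 + 1) -[in RHS]/(1 + 1) mpolyCD.
  transitivity (map_poly (@mpolyC _ K) (dpoly z) * ppoly K n l
    - Bpoly K n l * (\sum_(s < l.+1) (ahat s)%:P * map_poly (@mpolyC _ K) (('X - 1%:P) ^+ (l - s)))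
    + map_poly (@mpolyC _ K) (apoly z m) *
      (\sum_(s < l.+1) (ahat s)%:P * map_poly (@mpolyC _ K) (('X - 2%:P) ^+ (l - s)))).
    congr (_ - _ * _ + _ * _); apply: ppoly_shift => //; exact: (esym (mpolyC1 _ _)).
  rewrite BpolyE ppolyE mulr_suml.
  rewrite sumrB addrAC; congr (_ - _).
    rewrite !mulr_sumr -big_split; apply: eq_bigr => s _.
    by rewrite [map_poly _ (_ + _)]rmorphD /= !rmorphM /= map_polyXn mulrDr; congr (_ + _); rewrite mulrCA.
  rewrite [RHS]exchange_big; apply: eq_bigr => k _; rewrite mulr_sumr; apply: eq_bigr => s _.
  by rewrite polyCM [map_poly _ (_ * _)]rmorphM /= map_polyXn mulrACA.
have phiM a b : phi (a * b%:MP) = b *: phi a.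
  by rewrite mulrC mul_mpolyC linearZ.
rewrite DE coef_sum linear_sum; apply: eq_bigr => s _.
rewrite coefB coefCM coef_map linearB /= phiM; congr (_ - _).
rewrite coef_sum linear_sum; apply: eq_bigr => k _.
by rewrite coefCM coef_map /= phiM.
Qed.

Local Notation pi := (@AD_class K n l z m).
HB.instance Definition _ := GRing.RMorphism.copy pi (@qpi _ _ _ (fun i : 'I_(l + n) => qrel l z m i.+1)).
HB.instance Definition _ := GRing.Linear.copy pi (@qpi _ _ _ (fun i : 'I_(l + n) => qrel l z m i.+1)).

Lemma AD_class_qrel i : (0 < i <= l + n)%N -> pi (qrel l z m i) = 0.
Proof.
case: i => // i /= lt_i; rewrite /AD_class.
rewrite -[RHS](raddf0 (@qpi _ _ _ (fun i : 'I_(l + n) => qrel l z m i.+1))).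
apply/eqP; rewrite qpi_eq subr0; apply/ideal_genP.
exists (fun j => (j == Ordinal lt_i)%:R).
rewrite (bigD1 (Ordinal lt_i)) // eqxx mul1r -[LHS]addr0; congr (_ + _).
by rewrite big1 // => j /negPf->; rewrite mul0r.
Qed.

Lemma AD_classM f g : pi (f * g) = pi f * pi g.
Proof. exact: (rmorphM pi). Qed.

Lemma AD_class1 : pi 1 = 1.
Proof. exact: (rmorph1 pi). Qed.

Lemma AD_classP c f g : pi (c *: f + g) = c *: pi f + pi g.
Proof. exact: (linearP pi). Qed.

Lemma AD_class_surj f : exists F, f = pi F.
Proof. exact: qpiP. Qed.

Lemma AD_scalerAl (c : K) (x y : AD l z m) : c *: (x * y) = (c *: x) * y.
Proof. exact: quot_scalerAl. Qed.

Lemma AD_class_hhat k : (k < 3)%N -> pi (hhat k) = kappa l z m k *: (1 : AD l z m).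
Proof.
have piC c : pi c%:MP = c *: (1 : AD l z m).
  by rewrite -[c%:MP]mulr1 mul_mpolyC linearZ /= rmorph1.
case: k => [|[|[|//]]] _; rewrite -piC.
- by congr pi; rewrite /= -[2]/(1 + 1) -[in RHS]/(1 + 1) mpolyCD.
- have := @AD_class_qrel 1; rewrite /= addn_gt0 (ltnW n_ge2) orbT => /(_ isT).
  by rewrite raddfB => /eqP; rewrite subr_eq0 => /eqP.
- have := @AD_class_qrel 2; rewrite /= (leq_trans n_ge2) ?leq_addl // => /(_ isT).
  rewrite !raddfB /= -addrA -opprD => /eqP; rewrite subr_eq0 => /eqP ->.
  by rewrite -raddfD -mpolyCD.
Qed.
End Baxter.

Section AlgebraAD.
Variables (K : numFieldType) (n l : nat) (z m : 'I_n -> K).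
Hypothesis n_ge2 : (2 <= n)%N.
Local Notation S := {mpoly K[l + n]}.
Local Notation pi := (@AD_class K n l z m).

Lemma AD_class_hhat_ahat k s : (k < 3)%N ->
  pi (hhat K n l k * ahat K n l s) = kappa l z m k *: pi (ahat K n l s).
Proof. by move=> k3; rewrite AD_classM AD_class_hhat // -AD_scalerAl mul1r. Qed.

(** Below degree n - 2 + l the coefficients are the q_i with i >= 3. From there on they vanish
    because q_1 = q_2 = 0, the coefficient of degree n - 2 + l itself because the indicial factor is
    0 at s = 0. *)
Lemma AD_class_Dpoly j : pi (Dpoly l z m)`_j = 0.
Proof.
have [lt_j|le_j] := ltnP j (n - 2 + l).
  have e : (n - 2 + l = l + n - 2)%N by rewrite addnC addnBA.
  have := @AD_class_qrel K n l z m (l + n - j).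
  have j2 : (2 < l + n - j)%N by rewrite ltn_subRL addnC -ltn_subRL -e.
  rewrite (ltn_trans _ j2) // leq_subr => /(_ isT).
  have -> : qrel l z m (l + n - j) = (Dpoly l z m)`_j; last by [].
  have ej : j = (l + n - (l + n - j))%N.
    by rewrite subKn // (leq_trans (ltnW lt_j)) // e leq_subr.
  by rewrite [in RHS]ej; case: (l + n - j)%N j2 => [|[|[|i]]].
rewrite (Dpoly_coef z m pi) big1 // => s _.
have sl : (s <= l)%N by rewrite -ltnS.
have [t0 t1] := baxter_term_top (w := fun s => pi (ahat K n l s))
  (y := fun k s => pi (hhat K n l k * ahat K n l s)) n_ge2 sl (fun k => @AD_class_hhat_ahat k s).
move: le_j; rewrite leq_eqVlt => /orP[/eqP ej|lt_j]; last first.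
  by apply: t0; apply: leq_ltn_trans lt_j; rewrite leq_add2l leq_subr.
have [s0|s_gt0] := posnP s; last first.
  apply: t0; rewrite -ej ltn_add2l ltn_subrL s_gt0; exact: leq_trans sl.
move: t1; rewrite s0 mul0r scale0r subn0 ej; exact.
Qed.

(** The h_k generate A_D: the coefficient of degree n - 2 + (l - s) of the defining equation has an
    invertible factor at a_s by separation, and expresses a_s through the h_k and earlier a_s'. *)
Lemma AD_ind (P : AD l z m -> Prop) : separating l m -> P 1 ->
  (forall c x y, P x -> P y -> P (c *: x + y)) -> (forall x y, P x -> P y -> P (x * y)) ->
  (forall k, (1 <= k <= n)%N -> P (pi (hvar K n l k))) -> forall x, P x.
Proof.
move=> sep P1 Plin PM Ph.
have P0 : P 0 by have := Plin (-1) 1 1 P1 P1; rewrite scaleN1r addNr.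
have PZ c x : P x -> P (c *: x) by move=> Px; rewrite -[_ *: _]addr0; apply: Plin.
have PD x y : P x -> P y -> P (x + y) by move=> Px Py; rewrite -[x]scale1r; apply: Plin.
have PN x : P x -> P (- x) by move=> Px; rewrite -scaleN1r; apply: PZ.
have Psum (I : Type) (r : seq I) (Q : pred I) (F : I -> AD l z m) :
    (forall i, Q i -> P (F i)) -> P (\sum_(i <- r | Q i) F i).
  by move=> PF; elim/big_ind: _.
have Phh k : (k <= n)%N -> P (pi (hhat K n l k)).
  by case: k => [_|k kn]; [rewrite AD_class_hhat //; apply: PZ | apply: Ph].
have Pa s : (s <= l)%N -> P (pi (ahat K n l s)).
  have [N] := ubnP s; elim: N s => // N IH s; rewrite ltnS => sN sl.
  have [->|s_gt0] := posnP s; first by rewrite AD_class1.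
  have := AD_class_Dpoly (n - 2 + (l - s)).
  pose w s := pi (ahat K n l s); pose y k s := pi (hhat K n l k * ahat K n l s).
  rewrite (Dpoly_coef z m pi) -[X in X = 0]/(\sum_(s' < l.+1) baxter_term l z m w y s' (n - 2 + (l - s))).
  have top s' (s'l : (s' <= l)%N) :=
    baxter_term_top (w := w) (y := y) n_ge2 s'l (fun k => @AD_class_hhat_ahat k s').
  have sl1 : (s < l.+1)%N by [].
  rewrite (bigD1 (Ordinal sl1)) //= (top _ sl).2 => /eqP.
  rewrite addr_eq0 => /eqP/(congr1 (fun x => (s%:R * (\sum_i m i - 2 * l%:R + 1 + s%:R))^-1 *: x)).
  rewrite scalerA mulVf ?scale1r; last first.
    by rewrite mulf_neq0 ?sep ?s_gt0 // pnatr_eq0 -lt0n.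
  rewrite /w => ->; apply/PZ/PN/Psum => s'; rewrite -val_eqE /= => ne.
  have s'l : (s' <= l)%N by rewrite -ltnS.
  have [lt_s|le_s] := ltnP s' s; last first.
    rewrite (top _ s'l).1 // ltn_add2l ltn_sub2l // ?(leq_trans _ s'l) //.
      by rewrite ltn_neqAle eq_sym ne.
    by rewrite ltn_neqAle eq_sym ne.
  have Pw : P (w s') by apply: IH => //; apply: leq_trans sN.
  apply: PD; first exact: PZ.
  apply/PN/Psum => k _; apply: PZ; rewrite /y AD_classM; apply: PM => //.
  by apply: Phh; rewrite -ltnS.
move=> x; have [F ->] := AD_class_surj x.
move: F; apply: mpoly_mulX_ind => [|c p q Pp Pq|i p Pp].
- by rewrite AD_class1.
- by rewrite AD_classP; apply: Plin.
rewrite AD_classM; apply: PM => //.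
case: (split_ordP i) => j ->.
  by have := Pa j.+1 (ltn_ord j); rewrite /= /avar (big_pred1 j).
by have := Phh j.+1 (ltn_ord j); rewrite /= /hvar (big_pred1 j).
Qed.

Lemma AD_class_baxter t :
  pi ((\sum_(k < n.+1) (hhat K n l k) * (t ^+ (n - k))%:MP) * (ppoly K n l).[(t - 1)%:MP])
  = (dpoly z).[t] *: pi (ppoly K n l).[t%:MP] + (apoly z m).[t] *: pi (ppoly K n l).[(t - 2)%:MP].
Proof.
have mX j : t%:MP ^+ j = (t ^+ j)%:MP :> S by rewrite -rmorphXn.
have D0 : pi (Dpoly l z m).[t%:MP] = 0.
  rewrite horner_coef linear_sum big1 // => j _.
  by rewrite mX mulrC mul_mpolyC linearZ /= AD_class_Dpoly scaler0.
have mp (p : {poly K}) : (map_poly (@mpolyC _ K) p).[t%:MP] = p.[t]%:MP :> S.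
  by rewrite horner_map.
have c2 : 2 = 2%:MP :> S by rewrite -[2]/(1 + 1) -[in RHS]/(1 + 1) mpolyCD.
have DE : (Dpoly l z m).[t%:MP] = (dpoly z).[t]%:MP * (ppoly K n l).[t%:MP]
    - (Bpoly K n l).[t%:MP] * (ppoly K n l).[(t - 1)%:MP]
    + (apoly z m).[t]%:MP * (ppoly K n l).[(t - 2)%:MP].
  have shift c c' : c' = c%:MP -> (ppoly K n l \Po ('X - c'%:P)).[t%:MP] = (ppoly K n l).[(t - c)%:MP].
    by move=> ->; rewrite horner_comp hornerXsubC mpolyCB.
  apply: etrans (hornerD _ _ _) _; congr (_ + _); last first.
    by apply: etrans (hornerM _ _ _) _; congr (_ * _); [exact: mp | exact: shift].
  apply: etrans (hornerD _ _ _) _; congr (_ + _).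
    by apply: etrans (hornerM _ _ _) _; congr (_ * _); exact: mp.
  apply: etrans (hornerN _ _) _; congr (- _).
  apply: etrans (hornerM _ _ _) _; congr (_ * _); apply: shift; exact: (esym (mpolyC1 _ _)).
move: D0; rewrite DE !mul_mpolyC => /eqP.
rewrite raddfD raddfB /= !linearZ /= addrAC subr_eq0 => /eqP ->.
congr (pi (_ * _)); rewrite BpolyE horner_sum; apply: eq_bigr => k _.
by rewrite hornerM hornerC hornerXn mX.
Qed.
End AlgebraAD.

(** * The map tau *)

Section Weight.
Variables (K : numFieldType) (n l : nat) (z m : 'I_n -> K).
Hypothesis n_ge2 : (2 <= n)%N.
Local Notation S := {mpoly K[l + n]}.
Local Notation pi := (@AD_class K n l z m).
Implicit Types g : {linear AD l z m -> K^o}.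

Lemma prod_subX (s : seq K) :
  \prod_(t <- s) (t%:P - 'X) = (-1) ^+ size s *: \prod_(t <- s) ('X - t%:P).
Proof.
elim: s => [|t s IH]; first by rewrite !big_nil scale1r.
by rewrite !big_cons IH exprS -scalerA scaleN1r -scalerN -mulNr opprB scalerAr.
Qed.

Lemma size_prod_subX (s : seq K) : size (\prod_(t <- s) (t%:P - 'X)) = (size s).+1.
Proof. by rewrite prod_subX size_scale ?signr_eq0 // size_prod_XsubC. Qed.

Lemma meval_map_mpoly (f : {linear S -> K^o}) (p : {mpoly S[n]}) (v : 'I_n -> K) :
  (map_mpoly f p).@[v] = f p.@[fun i => (v i)%:MP].
Proof.
rewrite /map_mpoly /mmap raddf_sum /= mevalE linear_sum; apply: eq_bigr => mon _ /=.
rewrite mmap1_id mevalM mevalC mevalX.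
have -> : \prod_(i < n) (v i)%:MP ^+ mon i = (\prod_(i < n) v i ^+ mon i)%:MP :> S.
  by rewrite rmorph_prod; apply: eq_bigr => i _; rewrite rmorphXn.
by rewrite mulrC [in RHS]mulrC mul_mpolyC linearZ.
Qed.

Definition weight_prod (s : seq K) : S := \prod_(t <- s) (ppoly K n l).[(t - 1)%:MP].

Lemma omega_eval c (s : seq K) : size s = n.-1 ->
  (omega K n l).@[fun i => ((c *: \prod_(t <- s) ('X - t%:P))`_(n.-1 - i))%:MP]
  = (c ^+ l)%:MP * weight_prod s.
Proof.
move=> ss; have n_gt0 : (0 < n)%N by apply: ltnW.
have [_ om] := svalP (omega_exists K n l) n_gt0; rewrite -/(omega K n l) in om.
(* The point y_0 = c, y_j = t_j, at which the defining identity of [omega] is read off. *)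
pose eta (i : 'I_n.-1.+1) : S := if unlift ord0 i is Some j then (s`_j)%:MP else c%:MP.
have eta0 : eta ord0 = c%:MP by rewrite /eta unlift_none.
have etaS j : eta (lift ord0 j) = (s`_j)%:MP by rewrite /eta liftK.
have := congr1 (meval eta) om; rewrite comp_mpoly_meval rmorphM rmorphXn /= mevalXU eta0.
rewrite rmorph_prod /=.
have -> : \prod_(j < n.-1)
    ((map_poly (@mpolyC _ S) (ppoly K n l)).['X_(lift ord0 j) - 1]).@[eta] = weight_prod s.
  rewrite /weight_prod (big_nth 0) ss big_mkord; apply: eq_bigr => j _.
  rewrite -horner_map -map_poly_comp /=.
  have -> : map_poly (meval eta \o @mpolyC n.-1.+1 S) (ppoly K n l) = ppoly K n l.
    by rewrite map_poly_id // => x _; rewrite /= mevalC.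
  by rewrite rmorphB /= mevalXU etaS rmorph1 mpolyCB mpolyC1.
rewrite -rmorphXn => <-; apply: meval_eq => i.
rewrite tnth_mktuple -(coef_map (meval eta)) -[LHS](coef_map (@mpolyC (l + n) K)).
suff -> : map_poly (@mpolyC (l + n) K) (c *: \prod_(t <- s) ('X - t%:P))
    = map_poly (meval eta) (xpoly_y S n) by [].
rewrite /xpoly_y !map_polyZ /= mevalXU eta0 !rmorph_prod /= (big_nth 0) ss big_mkord.
congr (_ *: _); apply: eq_bigr => j _.
by rewrite !rmorphB /= !map_polyX !map_polyC /= mevalXU etaS.
Qed.

(** The sign comes from the factors t_j - u here against u - y_j in the definition of the y's;
    homogeneity raises it to the power l. *)
Lemma weight_pairingE g c (s : seq K) : size s = n.-1 ->
  ev (c *: \prod_(t <- s) (t%:P - 'X)) (weight_pairing g)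
  = ((-1) ^+ n.-1 * c) ^+ l * g (pi (weight_prod s)).
Proof.
move=> ss; rewrite prod_subX ss scalerA mulrC /ev.
pose f : {linear S -> K^o} := g \o pi.
rewrite -[weight_pairing g]/(map_mpoly f (omega K n l)) meval_map_mpoly omega_eval // mul_mpolyC.
by rewrite linearZ.
Qed.

Lemma weight_pairing_linear : linear (@weight_pairing K n l z m).
Proof.
move=> a g1 g2; apply/mpolyP => mon; rewrite mcoeffD mcoeffZ.
pose f (g : {linear AD l z m -> K^o}) : {linear S -> K^o} := g \o pi.
rewrite -[weight_pairing g1]/(map_mpoly (f g1) (omega K n l)).
rewrite -[weight_pairing g2]/(map_mpoly (f g2) (omega K n l)).
rewrite -[weight_pairing _]/(map_mpoly (f (a *: g1 + g2)) (omega K n l)).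
by rewrite !mcoeff_map_mpoly.
Qed.

Lemma weight_pairing_homog g : weight_pairing g \is l.-homog.
Proof.
have n_gt0 : (0 < n)%N by apply: ltnW.
have [om _] := svalP (omega_exists K n l) n_gt0.
apply/dhomogP => mon; rewrite mcoeff_msupp => nz; apply: (dhomog_mf om).
rewrite mcoeff_msupp; apply: contra nz => /eqP om0.
pose f : {linear S -> K^o} := g \o pi.
by rewrite -[weight_pairing g]/(map_mpoly f (omega K n l)) mcoeff_map_mpoly;
  apply/eqP; rewrite -[RHS](linear0 f); congr (f _).
Qed.

Lemma mul_dualE (f : AD l z m) g x : mul_dual f g x = g (f * x).
Proof. by []. Qed.

Lemma mul_dual_scalar c g : mul_dual (c *: (1 : AD l z m)) g = c *: g.
Proof.
by apply: lin_ext => x; rewrite mul_dualE -AD_scalerAl mul1r linearZ.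
Qed.

Section Transfer.
Variable T : holomorphic_rep z m.

(** Both sides become g of the same combination of p(t) and p(t - 2): the left by [Htilde_point],
    which moves the root t to t + 1 and t - 1, the right by the equation for p in A_D. *)
Lemma weight_pairing_baxter t q0 (s : seq K) g : (size s).+1 = n.-1 ->
  let q := q0 *: \prod_(t <- s) (t%:P - 'X) in
  \sum_(k < n.+1) t ^+ (n - k) * ev ((t%:P - 'X) * q) (Htilde T k (weight_pairing g))
  = \sum_(k < n.+1) t ^+ (n - k) * ev ((t%:P - 'X) * q)
      (weight_pairing (mul_dual (pi (hhat K n l k)) g)).
Proof.
move=> ss q; have n_gt0 : (0 < n)%N by apply: ltnW.
have qE t' : (t'%:P - 'X) * q = q0 *: \prod_(t <- t' :: s) (t%:P - 'X).
  by rewrite big_cons scalerAr.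
have sz t' : size (t' :: s) = n.-1 by [].
rewrite Htilde_point //; last first.
  by rewrite -ss (leq_trans (size_scale_leq _ _)) // size_prod_subX.
rewrite !qE !weight_pairingE //.
under [RHS]eq_bigr do rewrite weight_pairingE // mul_dualE mulrCA.
rewrite -mulr_sumr; set C := _ ^+ l; set s1 := t + 1 :: s; set s2 := t - 1 :: s.
transitivity (C * ((dpoly z).[t] * g (pi (weight_prod s1)) + (apoly z m).[t] * g (pi (weight_prod s2)))).
  by rewrite mulrDr !(mulrCA C).
congr (_ * _); rewrite {}/s1 {}/s2.
have Pc t' : weight_prod (t' :: s) = (ppoly K n l).[(t' - 1)%:MP] * weight_prod s.
  by rewrite /weight_prod big_cons.
have -> : \sum_(i < n.+1) t ^+ (n - i) * g (pi (hhat K n l i) * pi (weight_prod (t :: s)))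
   = g (pi ((\sum_(k < n.+1) (hhat K n l k) * (t ^+ (n - k))%:MP) * (ppoly K n l).[(t - 1)%:MP])
       * pi (weight_prod s)).
  rewrite Pc -AD_classM -mulrA mulr_suml linear_sum linear_sum; apply: eq_bigr => k _.
  rewrite -[RHS]/(g (pi _)) [_ * (t ^+ _)%:MP]mulrC -mulrA mul_mpolyC linearZ /= linearZ /=.
  by rewrite AD_classM.
rewrite AD_class_baxter // mulrDl -!AD_scalerAl linearD !linearZ /= -!AD_classM.
have -> : t - 2 = t - 1 - 1 by ring.
by rewrite (Pc (t + 1)) (Pc (t - 1)) addrK.
Qed.
End Transfer.
End Weight.

(** * Compatibility of tau with the H_k, and its injectivity *)

Section Tau.
Variables (K : numClosedFieldType) (n l : nat) (z m : 'I_n -> K) (T : holomorphic_rep z m).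
Hypothesis n_ge2 : (2 <= n)%N.
Local Notation S := {mpoly K[l + n]}.
Local Notation pi := (@AD_class K n l z m).
Implicit Types g : {linear AD l z m -> K^o}.

Lemma weight_pairing_kappa k g : (k < 3)%N ->
  weight_pairing (mul_dual (pi (hhat K n l k)) g) = kappa l z m k *: weight_pairing g.
Proof.
move=> k3; rewrite AD_class_hhat // mul_dual_scalar.
have := weight_pairing_linear (kappa l z m k) g 0.
rewrite addr0 => ->; rewrite -[RHS]addr0; congr (_ + _).
apply/mpolyP => mon; have := weight_pairing_linear (-1) g g.
by rewrite scaleN1r addNr => ->; rewrite scaleN1r addNr.
Qed.

(** At a point with distinct roots t_j, the differences of the two sides for all k are the
    coefficients of a polynomial vanishing at the n - 1 numbers t_j. As k = 0 and k = 1 agree by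
    scalars, its degree is at most n - 2, so it is zero. *)
Lemma Htilde_weight_pairing k g : (k <= n)%N ->
  Htilde T k (weight_pairing g) = weight_pairing (mul_dual (pi (hhat K n l k)) g).
Proof.
move=> kn; have n_gt0 : (0 < n)%N by apply: ltnW.
have low j : (j < 2)%N ->
    Htilde T j (weight_pairing g) = weight_pairing (mul_dual (pi (hhat K n l j)) g).
  case: j => [|[|//]] _; rewrite weight_pairing_kappa //.
    exact: Htilde0.
  exact: Htilde1.
apply/eqP; rewrite -subr_eq0; apply/eqP; apply: ev_eq0 => // c s ss us.
set q := _ *: _.
pose e j := ev q (Htilde T j (weight_pairing g) - weight_pairing (mul_dual (pi (hhat K n l j)) g)).
rewrite -[LHS]/(e k).
pose E := \sum_(j < n.+1) e j *: 'X^(n - j).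
have coefE (j : nat) : (j <= n)%N -> E`_(n - j) = e j.
  move=> jn; have jn1 : (j < n.+1)%N by [].
  rewrite coef_sum (bigD1 (Ordinal jn1)) //= coefZ coefXn eqxx mulr1 big1 ?addr0 // => i ij.
  rewrite coefZ coefXn [_ == _](_ : _ = false) ?mulr0 //.
  apply: contraNF ij => /eqP/(congr1 (subn n)); rewrite !subKn // -1?ltnS // => ij.
  by apply/eqP/val_inj.
suff E0 : E = 0 by rewrite -coefE // E0 coef0.
apply/eqP/contraT => nzE; have := max_poly_roots nzE _ us.
have -> : all (root E) s.
  apply/allP => t ts; apply/rootP; rewrite horner_sum.
  have qE : q = (t%:P - 'X) * (c *: \prod_(t <- rem t s) (t%:P - 'X)).
    by rewrite /q (perm_big _ (perm_to_rem ts)) big_cons scalerAr.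
  have := @weight_pairing_baxter K n l z m n_ge2 T t c (rem t s) g.
  rewrite size_rem // ss prednK; last by rewrite -subn1 subn_gt0.
  move=> /(_ erefl) /=; rewrite -qE => /eqP; rewrite -subr_eq0 -sumrB => /eqP eq0.
  rewrite -[RHS]eq0; apply: eq_bigr => j _.
  by rewrite hornerZ hornerXn /e raddfB mulrBl ![_ * t ^+ _]mulrC.
move=> /(_ isT); rewrite ss ltnNge => /negP[]; apply/leq_sizeP => j le_j.
have [lt_nj|le_jn] := ltnP n j.
  rewrite coef_sum big1 // => i _; rewrite coefZ coefXn gtn_eqF ?mulr0 //.
  by apply: leq_ltn_trans lt_nj; apply: leq_subr.
rewrite -(subKn le_jn) coefE ?leq_subr // /e low ?subrr ?raddf0 //.
by rewrite ltn_subLR // addn2 -[X in (X < _)%N](prednK n_gt0) !ltnS.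
Qed.

Lemma weight_pairing_e12 g : T i2 i1 1%N (weight_pairing g) = 0.
Proof.
have := Htilde2 T n_ge2 (weight_pairing_homog n_ge2 g).
rewrite Htilde_weight_pairing // weight_pairing_kappa // /kappa -[_ + _ + dcoef z 2]addrA acoef2 //.
rewrite -[LHS]add0r => /addIr /esym/eqP; rewrite mulf_eq0 => /orP[|/eqP//].
have -> : xvar K n 1 = 'X_(Ordinal (ltnW n_ge2)) := xvar_ord K (Ordinal (ltnW n_ge2)).
move=> /eqP/(congr1 (mcoeff U_(Ordinal (ltnW n_ge2))%MM)).
by rewrite mcoeffX eqxx raddf0 => /eqP; rewrite oner_eq0.
Qed.

Lemma weight_pairing_sing g : weight_pairing g \in sing_pred T l.
Proof. by rewrite sing_predE weight_pairing_homog // weight_pairing_e12 eqxx. Qed.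

Lemma mul_dualM f1 f2 g : mul_dual (f1 * f2) g = mul_dual f1 (mul_dual f2 g).
Proof. by apply: lin_ext => x; rewrite !mul_dualE mulrAC mulrC mulrA. Qed.

Lemma mul_dual1 g : mul_dual 1 g = g.
Proof. by apply: lin_ext => x; rewrite mul_dualE mul1r. Qed.

Lemma mul_dual_lin c f1 f2 g : mul_dual (c *: f1 + f2) g = c *: mul_dual f1 g + mul_dual f2 g.
Proof.
by apply: lin_ext => x; rewrite mul_dualE mulrDl -AD_scalerAl linearD linearZ.
Qed.

Hypothesis sep : separating l m.

(** The kernel is stable under the L_(h_k)^*, which correspond to the H_k, and the h_k generate
    A_D. *)
Lemma weight_pairing_mul_dual f g : weight_pairing g = 0 -> weight_pairing (mul_dual f g) = 0.
Proof.
pose P (f : AD l z m) := forall g, weight_pairing g = 0 -> weight_pairing (mul_dual f g) = 0.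
suff Pf : P f by exact: (Pf g).
apply: (@AD_ind K n l z m n_ge2 P sep).
- by move=> {}g; rewrite mul_dual1.
- move=> c x y Px Py {}g g0; rewrite mul_dual_lin weight_pairing_linear Px // Py //.
  by rewrite scaler0 addr0.
- by move=> x y Px Py {}g g0; rewrite mul_dualM; apply/Px/Py.
move=> k /andP[k0 kn] {}g g0.
have -> : hvar K n l k = hhat K n l k by case: (k) k0.
by rewrite -(Htilde_weight_pairing g kn) g0 linear0.
Qed.

Lemma weight_pairing_inj g : weight_pairing g = 0 -> g = 0.
Proof.
move=> g0.
(* The factors p(t_j - 1) are removed one at a time; r counts those removed. *)
have Pr (r : nat) : forall f (s : seq K), size s = (n.-1 - r)%N -> g (f * pi (weight_prod n l s)) = 0.
  elim: r => [|r IH] f s.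
    rewrite subn0 => ss; have := weight_pairing_mul_dual f g0.
    move=> /(congr1 (ev (1 *: \prod_(t <- s) (t%:P - 'X)))).
    rewrite weight_pairingE // raddf0 mul_dualE mulr1 => /eqP.
    by rewrite mulf_eq0 expf_eq0 signr_eq0 andbF => /eqP.
  (* From r = n - 1 on the truncated difference stays 0, and there is no factor left to remove. *)
  have [rn|rn] := ltnP r n.-1; last first.
    move=> ss; apply: IH; rewrite ss; apply/eqP.
    by rewrite eq_sym; move: rn (leqW rn); rewrite -!subn_eq0 => /eqP -> /eqP ->.
  move=> ss.
  pose phi (x : S) : K := g (f * pi (x * weight_prod n l s)).
  have phi_lin : linear (phi : S -> K^o).
    move=> c x y; rewrite /phi mulrDl -scalerAl AD_classP mulrDr.
    by rewrite [f * (_ *: _)]mulrC -AD_scalerAl [_ * f]mulrC linearP.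
  pose m0 := GRing.isLinear.Build K S K^o _ (phi : S -> K^o) phi_lin.
  pose phi' : {linear S -> K^o} := HB.pack (phi : S -> K^o) m0.
  (* [Q] is g(f p(t) times the remaining factors) as a polynomial in t. It vanishes identically, and
     its coefficient of t^l is the value without p(t), as p is monic. *)
  pose Q := \poly_(j < l.+1) phi' (ppoly K n l)`_j.
  have Q0 : Q = 0.
    apply: (@poly_eq0_horner K Q [::]) => t _.
    have st : size (t + 1 :: s) = (n.-1 - r)%N by rewrite /= ss subnSK.
    have := IH f _ st; rewrite /weight_prod big_cons addrK -/(weight_prod n l s) -[LHS]/(phi' _).
    rewrite horner_coef size_ppoly linear_sum horner_poly => h; rewrite -[RHS]h.
    apply: eq_bigr => j _; have -> : t%:MP ^+ j = (t ^+ j)%:MP :> S by rewrite -rmorphXn.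
    by rewrite [in RHS]mulrC mul_mpolyC linearZ mulrC.
  have := congr1 (fun p : {poly K} => p`_l) Q0; rewrite coef_poly ltnS leqnn coef0.
  have := monicP (ppoly_monic K n l); rewrite lead_coefE size_ppoly /= => ->.
  by move=> h; have : phi 1 = 0 := h; rewrite /phi mul1r.
apply: lin_ext => f; have := Pr n.-1 f [::]; rewrite subnn => /(_ erefl).
by rewrite /weight_prod big_nil AD_class1 mulr1.
Qed.
End Tau.

(** * The action of A_D on singular vectors *)

Section PolyAct.
Variables (K : numFieldType) (V : lmodType K) (N : nat) (B : 'I_N -> {linear V -> V}).
Hypothesis B_comm : forall i j, B i * B j = B j * B i.
Local Notation S := {mpoly K[N]}.

(** Together with [poly_act], the substitution of commuting operators for the variables. *)
Definition mono_act (mon : 'X_{1..N}) : {linear V -> V} := \prod_(i < N) B i ^+ mon i.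

Definition poly_act (F : S) : {linear V -> V} := \sum_(mon <- msupp F) F@_mon *: mono_act mon.

Lemma mono_actD m1 m2 : mono_act (m1 + m2)%MM = mono_act m1 * mono_act m2.
Proof.
rewrite /mono_act -prodrM_comm => [|i j _ _]; last by apply/commrX/commr_sym/commrX.
by apply: eq_bigr => i _; rewrite mnmDE exprD.
Qed.

Lemma mono_act1 i : mono_act U_(i)%MM = B i.
Proof.
rewrite -[RHS](big_pred1_eq *%R i B) big_mkcond; apply: eq_bigr => j _.
by rewrite mnm1E eq_sym; case: eqP.
Qed.

Lemma poly_actE k F : (msize F <= k)%N ->
  poly_act F = \sum_(mon : 'X_{1..N < k}) F@_mon *: mono_act mon.
Proof.
move=> le_Fk; pose I : subFinType _ := 'X_{1..N < k}.
rewrite /poly_act (ssrcomplements.big_mksub I) ?msupp_uniq //=; last first.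
  by move=> mon /msize_mdeg_lt /leq_trans; apply.
by rewrite big_rmcond //= => j /memN_msupp_eq0 ->; rewrite scale0r.
Qed.

Lemma poly_act_linear : linear poly_act.
Proof.
move=> c F G; pose k := maxn (msize (c *: F + G)) (maxn (msize F) (msize G)).
rewrite !(@poly_actE k) ?leq_max ?leqnn ?orbT //.
rewrite scaler_sumr -big_split; apply: eq_bigr => mon _ /=.
by rewrite mcoeffD mcoeffZ scalerDl scalerA.
Qed.
HB.instance Definition _ := GRing.isLinear.Build K S {linear V -> V} _ poly_act poly_act_linear.

Lemma poly_actX mon : poly_act 'X_[mon] = mono_act mon.
Proof. by rewrite /poly_act msuppX big_seq1 mcoeffX eqxx scale1r. Qed.

Lemma poly_act1 : poly_act 1 = 1.
Proof. by rewrite -mpolyX0 poly_actX /mono_act big1 // => i _; rewrite mnm0E. Qed.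

Lemma poly_act_var i : poly_act 'X_i = B i.
Proof. by rewrite poly_actX mono_act1. Qed.

Lemma poly_act_mulX i G : poly_act ('X_i * G) = B i * poly_act G.
Proof.
rewrite [G]mpolyE mulr_sumr !linear_sum mulr_sumr; apply: eq_bigr => mon _.
by rewrite -scalerAr !linearZ /= -mpolyXD !poly_actX mono_actD mono_act1 lin_scaleAr.
Qed.

Lemma poly_actM F G : poly_act (F * G) = poly_act F * poly_act G.
Proof.
move: F; apply: mpoly_mulX_ind => [|c p q IHp IHq|i p IH].
- by rewrite poly_act1 !mul1r.
- by rewrite mulrDl -scalerAl !linearP /= IHp IHq mulrDl lin_scaleAl.
- by rewrite -mulrA !poly_act_mulX IH mulrA.
Qed.
End PolyAct.

Lemma coef_comp_shift (K : numFieldType) (p : {poly K}) c l : (size p <= l.+1)%N ->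
  (size (p \Po ('X + c%:P)) <= l.+1)%N /\ (p \Po ('X + c%:P))`_l = p`_l.
Proof.
move=> sp; split; first by rewrite size_comp_poly2 // size_XaddC.
have top i : size (('X + c%:P) ^+ i) = i.+1 /\ (('X + c%:P) ^+ i)`_i = 1.
  have mon : ('X + c%:P) ^+ i \is monic by rewrite monic_exp // monicXaddC.
  have s : size (('X + c%:P) ^+ i) = i.+1 by rewrite -[c]opprK polyCN size_exp_XsubC.
  by split=> //; move/monicP: mon; rewrite lead_coefE s.
rewrite comp_polyE (big_ord_widen l.+1 (fun i => p`_i *: ('X + c%:P) ^+ i)) //.
rewrite big_mkcond coef_sum big_ord_recr /= big1 ?add0r => [|i _].
  case: ifP => lp; first by rewrite coefZ (top l).2 mulr1.
  by rewrite coef0 nth_default // leqNgt lp.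
case: ifP => _; last by rewrite coef0.
by rewrite coefZ [X in _ * X]nth_default ?mulr0 // (top i).1.
Qed.

(** * Baxter's equation for a singular vector *)

Section SingSide.
Variables (K : numClosedFieldType) (n l : nat) (z m : 'I_n -> K) (T : holomorphic_rep z m).
Hypothesis n_ge2 : (2 <= n)%N.
Local Notation S := {mpoly K[l + n]}.
Local Notation E := {linear Sing T l -> Sing T l}.
Implicit Types (q : {poly K}) (v : Sing T l).

Definition evS q v : K^o := ev q (sing_val v).

Lemma sing_valP a u v : sing_val (a *: u + v) = a *: sing_val u + sing_val v.
Proof. exact: (linearP (\val : Sing T l -> {mpoly K[n]})). Qed.

Lemma sing_valZ a (u : Sing T l) : sing_val (a *: u) = a *: sing_val u.
Proof. exact: (linearZZ (\val : Sing T l -> {mpoly K[n]})). Qed.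

Fact evS_linear q : linear (evS q).
Proof. by move=> a u v; rewrite /evS sing_valP raddfD /= evZ. Qed.
HB.instance Definition _ q := GRing.isLinear.Build K (Sing T l) K^o _ (evS q) (evS_linear q).

Lemma sing_homog v : sing_val v \is l.-homog.
Proof. by have := valP v; rewrite sing_predE => /andP[]. Qed.

(** As n >= 2, each point used in [ev_eq0] has at least one linear factor to split off. *)
Lemma evS_eq0 v : (forall t q, (size q <= n.-1)%N -> evS ((t%:P - 'X) * q) v = 0) -> v = 0.
Proof.
move=> v0; apply: val_inj; rewrite [RHS](linear0 (\val : Sing T l -> {mpoly K[n]})); apply: ev_eq0 => [|c [|t s] ss _]; first exact: ltnW.
  by move/esym/eqP: ss; rewrite -subn1 subn_eq0 leqNgt n_ge2.
rewrite big_cons scalerAr; apply: v0.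
by rewrite (leq_trans (size_scale_leq _ _)) // size_prod_subX -ss.
Qed.

(** The polynomial t |-> v((t + 1 - u) q(u)). The shift matches the p(t - 1) that the weight
    function attaches to a root t, so that this polynomial satisfies the equation of p. *)
Definition shift_line q v : {poly K} := line q (sing_val v) \Po ('X + 1%:P).

Definition wcoef q v s : K^o := (shift_line q v)`_(l - s).

Lemma shift_line_homog q v : (size (shift_line q v) <= l.+1)%N /\ wcoef q v 0 = evS q v.
Proof.
have [sl cl] := line_homog q (sing_homog v).
have [ssl scl] := coef_comp_shift 1 sl.
by split=> //; rewrite /wcoef subn0 /shift_line scl cl.
Qed.

Lemma shift_lineE q v : shift_line q v = \sum_(s < l.+1) wcoef q v s *: 'X^(l - s).
Proof.
have [sl _] := shift_line_homog q v.
apply/polyP => j; rewrite coef_sum; have [lj|jl] := ltnP l j.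
  rewrite nth_default ?(leq_trans sl) // big1 // => s _.
  by rewrite coefZ coefXn gtn_eqF ?mulr0 // (leq_ltn_trans _ lj) ?leq_subr.
have jl1 : (l - j < l.+1)%N by rewrite ltnS leq_subr.
rewrite (bigD1 (Ordinal jl1)) //= coefZ coefXn /wcoef subKn // eqxx mulr1 big1 ?addr0 // => s sj.
rewrite coefZ coefXn [_ == _](_ : _ = false) ?mulr0 //.
apply: contraNF sj => /eqP ej; apply/eqP/val_inj; rewrite /= [in RHS]ej subKn //.
by rewrite -ltnS.
Qed.

Lemma wcoef_linear q s : linear (fun v => wcoef q v s).
Proof.
move=> a u v; rewrite /wcoef /shift_line sing_valP [line q _]linearP /= comp_polyD comp_polyZ.
by rewrite coefD coefZ.
Qed.

Lemma horner_shift_line q v t : (shift_line q v).[t] = evS (((t + 1)%:P - 'X) * q) v.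
Proof. by rewrite /shift_line horner_comp !hornerE horner_line. Qed.

Lemma shift_line_baxter q v : (size q <= n.-1)%N ->
  dpoly z * shift_line q v
  - \sum_(k < n.+1) 'X^(n - k) * (shift_line q (H T l k v) \Po ('X - 1%:P))
  + apoly z m * (shift_line q v \Po ('X - 2%:P)) = 0.
Proof.
move=> sq; apply: (@poly_eq0_horner K _ [::]) => t _.
have hc u c : (shift_line q u \Po ('X - c%:P)).[t] = evS (((t - c + 1)%:P - 'X) * q) u.
  by rewrite horner_comp hornerXsubC horner_shift_line.
rewrite !(hornerD, hornerN, hornerM) horner_sum horner_shift_line hc.
have -> : t - 2 + 1 = t - 1 by ring.
have := Htilde_point T t (sing_val v) (ltnW n_ge2) sq.
rewrite -/(evS _ v) -/(evS (((t - 1)%:P - 'X) * q) v) addrAC => <-.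
apply/eqP; rewrite subr_eq0; apply/eqP; apply: eq_bigr => k _.
by rewrite hornerM hornerXn hc subrK.
Qed.

Lemma wcoef_baxter q v j : (size q <= n.-1)%N ->
  \sum_(s < l.+1) baxter_term l z m (wcoef q v)
     (fun k s => wcoef q (H T l k v) s) s j = 0.
Proof.
move=> sq; have := congr1 (fun p : {poly K} => p`_j) (shift_line_baxter v sq).
rewrite [RHS]coef0 => c0; rewrite -[RHS]c0 /baxter_term sumrB coefD coefB addrAC -coefD; congr (_ - _).
  rewrite !shift_lineE raddf_sum /= !mulr_sumr -big_split coef_sum; apply: eq_bigr => s _ /=.
  by rewrite comp_polyZ comp_Xn_poly -!scalerAr -scalerDr coefZ [RHS]mulrC.
rewrite exchange_big coef_sum; apply: eq_bigr => k _.
rewrite shift_lineE raddf_sum /= mulr_sumr coef_sum; apply: eq_bigr => s _.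
by rewrite comp_polyZ comp_Xn_poly -scalerAr coefZ [RHS]mulrC.
Qed.
End SingSide.

Section Commutant.
Variables (K : comNzRingType) (V : lmodType K) (G : {linear V -> V} -> Prop).
Local Notation E := {linear V -> V}.

Lemma subalg_gen_comm : (forall f g, G f -> G g -> f * g = g * f) ->
  forall f g, f \in subalg_gen G -> g \in subalg_gen G -> f * g = g * f.
Proof.
move=> Gcomm.
(* The commutant of h is a unital subalgebra; the claim follows by using this first for generators,
   then for arbitrary elements. *)
have centr (h : E) : (forall g, G g -> h * g = g * h) ->
    forall f, f \in subalg_gen G -> h * f = f * h.
  move=> hG f /subalg_genP fB; apply/asboolP; apply: (fB (fun x : E => `[< h * x = x * h >])).
  - by apply/asboolP; rewrite mulr1 mul1r.
  - move=> a u v /asboolP hu /asboolP hv; apply/asboolP.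
    rewrite mulrDr mulrDl hv; congr (_ + _); apply: lin_ext => x.
    rewrite -[LHS]/(h (a *: u x)) linearZ /=.
    by rewrite -[h (u x)]/((h * u) x) hu.
  - by move=> u v /asboolP hu /asboolP hv; apply/asboolP; rewrite mulrA hu -mulrA hv mulrA.
  - by move=> g Gg; apply/asboolP/hG.
move=> f g fG gG; apply: (centr f) => // g' Gg'; apply/esym/(centr g') => // g'' Gg''.
exact: Gcomm.
Qed.
End Commutant.

Section Psi.
Variables (K : numClosedFieldType) (n l : nat) (z m : 'I_n -> K) (T : holomorphic_rep z m).
Hypothesis n_ge2 : (2 <= n)%N.
Hypothesis sep : separating l m.
Local Notation S := {mpoly K[l + n]}.
Local Notation E := {linear Sing T l -> Sing T l}.
Local Notation gen := (subalg_gen (fun f : E => exists2 k, (1 <= k <= n)%N & f = H T l k)).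
Implicit Types (q : {poly K}) (v : Sing T l).

Lemma H_comm j k : H T l j * H T l k = H T l k * H T l j.
Proof.
apply: lin_ext => v; apply: val_inj; rewrite !linME /= .
by have /(congr1 (fun f : {linear _ -> _} => f (sing_val v))) := Htilde_comm T j k.
Qed.

Lemma gen_comm f g : f \in gen -> g \in gen -> f * g = g * f.
Proof. by apply: subalg_gen_comm => _ _ [j _ ->] [k _ ->]; apply: H_comm. Qed.

Lemma H_kappa k v : (k < 3)%N -> H T l k v = kappa l z m k *: v.
Proof.
move=> k3; apply: val_inj; rewrite -[LHS]/(Htilde T k (sing_val v)) [RHS]sing_valZ.
case: k k3 => [|[|[|//]]] _.
- exact: Htilde0.
- exact: Htilde1.
rewrite (Htilde2 T n_ge2 (sing_homog v)) -[_ + _ + dcoef z 2]addrA acoef2 //.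
have := valP v; rewrite sing_predE => /andP[_ /eqP e12].
by rewrite [T _ _ _ _]e12 mulr0 add0r.
Qed.

Lemma H_gen k : (k <= n)%N -> H T l k \in gen.
Proof.
case: k => [_|k kn]; last by apply: mem_subalg_gen; exists k.+1.
have -> : H T l 0 = 2 *: (1 : E) by apply: lin_ext => v; rewrite H_kappa.
by apply: rpredZ; apply: rpred1.
Qed.

(** The coefficient of degree n - 2 + (l - s) of Baxter's equation determines [wcoef q v s] from the
    earlier coefficients of v and of the H_k v. Its factors depend neither on q nor on v, so one
    operator b serves all of them. *)
Lemma beta_exists s : (s <= l)%N -> exists2 b : E, b \in gen &
  forall q v, (size q <= n.-1)%N -> wcoef q v s = evS q (b v).
Proof.
have [N] := ubnP s; elim: N s => // N IH s; rewrite ltnS => sN sl.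
have [->|s_gt0] := posnP s.
  exists 1 => [|q v sq]; first exact: rpred1.
  by rewrite (shift_line_homog q v).2.
have /choice[b bP] : forall s', exists b : E, (s' < s)%N -> b \in gen /\
    forall q v, (size q <= n.-1)%N -> wcoef q v s' = evS q (b v).
  move=> s'; have [lt_s|_] := ltnP s' s; last by exists 1.
  have [b bg bw] := IH s' (leq_trans lt_s sN) (leq_trans (ltnW lt_s) sl).
  by exists b.
pose c := s%:R * (\sum_i m i - 2 * l%:R + 1 + s%:R).
have c0 : c != 0 by rewrite mulf_neq0 ?sep ?s_gt0 // pnatr_eq0 -lt0n.
pose j := (n - 2 + (l - s))%N.
(* The earlier terms of Baxter's equation, with h_k w_s' read as [b s'] applied to H_k v. *)
pose b1 : E := \sum_(s' < l.+1 | (s' < s)%N)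
  baxter_term l z m b (fun k s => b s * H T l k) s' j.
exists (- c^-1 *: b1) => [|q v sq].
  apply: rpredZ; apply: rpred_sum => s' ss'; have [bg _] := bP s' ss'.
  apply: rpredB; first exact: rpredZ.
  apply: rpred_sum => k _; apply: rpredZ; apply: rpredM => //.
  by apply: H_gen; rewrite -ltnS.
have := wcoef_baxter n_ge2 v j sq.
have top s' (s'l : (s' <= l)%N) := baxter_term_top (z := z) (m := m) (w := wcoef q v)
  (y := fun k s => wcoef q (H T l k v) s) n_ge2 s'l.
have yk s' k : (k < 3)%N -> wcoef q (H T l k v) s' = kappa l z m k *: wcoef q v s'.
  move=> k3; rewrite H_kappa //.
  pose f := GRing.isLinear.Build K (Sing T l) K^o _ (fun v => wcoef q v s') (wcoef_linear q s').
  pose F : {linear Sing T l -> K^o} := HB.pack (fun v => wcoef q v s') f.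
  exact: (linearZZ F).
have sl1 : (s < l.+1)%N by [].
rewrite (bigD1 (Ordinal sl1)) //= (top _ sl (fun k => yk s k)).2 -/c => /eqP.
rewrite addr_eq0 => /eqP/(congr1 (fun x => c^-1 *: x)).
rewrite scalerA mulVf // scale1r => ->.
rewrite linearZ /= scaleNr scalerN; congr (- (_ *: _)).
rewrite /b1 lin_sumE linear_sum /= big_mkcond [RHS]big_mkcond /=; apply: eq_bigr => s' _.
rewrite -val_eqE /=; have s'l : (s' <= l)%N by rewrite -ltnS.
have [lt_s|lt_s|//] := ltngtP s' s; last first.
  by rewrite (top _ s'l (fun k => yk s' k)).1 // /j ltn_add2l ltn_sub2l // (leq_trans lt_s).
have [_ bw] := bP _ lt_s.
rewrite /baxter_term /= linearB /= linearZ /= bw //; congr (_ - _).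
rewrite lin_sumE linear_sum; apply: eq_bigr => k _.
by rewrite /= linearZ /= bw.
Qed.
End Psi.

Section PsiAction.
Variables (K : numClosedFieldType) (n l : nat) (z m : 'I_n -> K) (T : holomorphic_rep z m).
Hypothesis n_ge2 : (2 <= n)%N.
Hypothesis sep : separating l m.
Local Notation S := {mpoly K[l + n]}.
Local Notation E := {linear Sing T l -> Sing T l}.
Local Notation gen := (subalg_gen (fun f : E => exists2 k, (1 <= k <= n)%N & f = H T l k)).
Implicit Types (q : {poly K}) (v : Sing T l).

(* An action of C[a, h] on Sing in which h_k acts as H_k, and a_s turns the leading
   coefficient of v((t + 1 - x) q(x)), as a polynomial in t, into that of t^(l-s). *)
Definition bethe_action (Psi : {linear S -> E}) : Prop :=
  [/\ Psi 1 = 1, forall F G : S, Psi (F * G) = Psi F * Psi G, forall F, Psi F \in gen,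
      forall k, (1 <= k <= n)%N -> Psi (hvar K n l k) = H T l k &
      forall (q : {poly K}) (v : Sing T l) s, (s <= l)%N -> (size q <= n.-1)%N ->
        wcoef q v s = evS q (Psi (ahat K n l s) v)].

Lemma bethe_action_exists : exists Psi, bethe_action Psi.
Proof.
have /choice[b bP] : forall s, exists b : E, (s <= l)%N -> b \in gen /\
    forall q v, (size q <= n.-1)%N -> wcoef q v s = evS q (b v).
  move=> s; have [sl|_] := leqP s l; last by exists 1.
  by have [b bg bw] := beta_exists T n_ge2 sep sl; exists b.
pose B (i : 'I_(l + n)) : E :=
  match split i with inl j => b j.+1 | inr k => H T l k.+1 end.
have Bgen i : B i \in gen.
  rewrite /B; case: (split i) => j; first by have [] := bP j.+1 (ltn_ord j).
  exact: H_gen.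
have Bcomm i j : B i * B j = B j * B i by apply: gen_comm.
pose P := HB.pack_for {linear S -> E} (poly_act B)
  (GRing.isLinear.Build K S E _ (poly_act B) (poly_act_linear B)).
exists P; split=> [|F G|F|[//|k] kn|q v [|s] sl sq].
- exact: poly_act1.
- exact: poly_actM.
- apply: rpred_sum => mon _; apply: rpredZ; apply: rpred_prod => i _.
  exact: rpredX.
- rewrite -[LHS]/(poly_act B _) /hvar (big_pred1 (Ordinal (n := n) kn)) => [|j].
    by rewrite poly_act_var /B -[rshift _ _]/(unsplit (inr _)) unsplitK.
  by rewrite eqSS.
- rewrite (shift_line_homog q v).2 -[P _]/(poly_act B 1) poly_act1.
  by [].
have [_ -> //] := bP _ sl.
rewrite -[P _]/(poly_act B _) /= /avar (big_pred1 (Ordinal (n := l) sl)) => [|j].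
  by rewrite poly_act_var /B -[lshift _ _]/(unsplit (inl _)) unsplitK.
by rewrite eqSS.
Qed.

Variable Psi : {linear S -> E}.
Hypothesis PsiP : bethe_action Psi.

Let Psi1 : Psi 1 = 1. Proof. by case: PsiP. Qed.
Let PsiM (F G : S) : Psi (F * G) = Psi F * Psi G. Proof. by case: PsiP. Qed.
Let Psi_gen F : Psi F \in gen. Proof. by case: PsiP. Qed.
Let Psi_h k : (1 <= k <= n)%N -> Psi (hvar K n l k) = H T l k.
Proof. by case: PsiP => _ _ _ + _; apply. Qed.
Let Psi_a q v s : (s <= l)%N -> (size q <= n.-1)%N ->
  wcoef q v s = evS q (Psi (ahat K n l s) v).
Proof. by case: PsiP => _ _ _ _; apply. Qed.

Lemma PsiC c v : Psi c%:MP v = c *: v.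
Proof. by rewrite -[c%:MP]mulr1 mul_mpolyC linearZ /= Psi1. Qed.

Lemma Psi_hhat k : (k <= n)%N -> Psi (hhat K n l k) = H T l k.
Proof.
case: k => [_|k kn]; last exact: Psi_h.
apply: lin_ext => v; rewrite (H_kappa n_ge2) // -PsiC; congr (Psi _ v).
by rewrite /= -[2]/(1 + 1) -[in RHS]/(1 + 1) mpolyCD.
Qed.

Lemma Psi_Dpoly j : Psi (Dpoly l z m)`_j = 0.
Proof.
(* By commutativity the H_k can be applied to v first, and the value becomes the left side of
   [wcoef_baxter]. *)
have ev0 q v : (size q <= n.-1)%N -> evS q (Psi (Dpoly l z m)`_j v) = 0.
  move=> sq.
  pose phi (F : S) : K^o := evS q (Psi F v).
  have phi_lin : linear phi by move=> c F G; rewrite /phi !linearP.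
  pose phi' : {linear S -> K^o} := HB.pack phi (GRing.isLinear.Build K S K^o _ phi phi_lin).
  rewrite -[LHS]/(phi' _) (Dpoly_coef z m phi') -[RHS](wcoef_baxter n_ge2 v j sq).
  apply: eq_bigr => s _; have sl : (s <= l)%N by rewrite -ltnS.
  rewrite /baxter_term; congr (_ *: _ - _); first exact/esym/Psi_a.
  apply: eq_bigr => k _; have kn : (k <= n)%N by rewrite -ltnS.
  congr (_ *: _); rewrite -[LHS]/(evS q (Psi _ v)) PsiM (gen_comm (Psi_gen _) (Psi_gen _)).
  by rewrite Psi_hhat // Psi_a.
apply: lin_ext => v; apply: (evS_eq0 n_ge2) => t q sq.
(* [ev0] only reaches points q of degree below n - 1. At (t - u) q(u), the value of N v has as
   coefficients, after a shift of t, the values at q of Psi(a_s) N v = N Psi(a_s) v, which [ev0]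
   makes zero. *)
set N := Psi _; have Nv0 : shift_line q (N v) = 0.
  rewrite shift_lineE big1 // => s _; rewrite Psi_a -1?ltnS //.
  by rewrite -linME (gen_comm (Psi_gen _) (Psi_gen _)) linME ev0 // scale0r.
by have := horner_shift_line q (N v) (t - 1); rewrite subrK => <-; rewrite Nv0 horner0.
Qed.

Lemma Psi_qrel i : (0 < i)%N -> Psi (qrel l z m i) = 0.
Proof.
case: i => [//|[|[|i]]] _; last exact: Psi_Dpoly.
- apply: lin_ext => v; rewrite /= linearB /= Psi_h ?(ltnW n_ge2) // PsiC.
  by rewrite (H_kappa n_ge2) // subrr.
- apply: lin_ext => v; rewrite /= -addrA -opprD -mpolyCD linearB /= Psi_h ?n_ge2 // PsiC.
  by rewrite (H_kappa n_ge2) // subrr.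
Qed.

Lemma Psi_factor F G : AD_class z m F = AD_class z m G -> Psi F = Psi G.
Proof.
move=> /eqP; rewrite qpi_eq => /ideal_genP[c FG].
apply/eqP; rewrite -subr_eq0 -linearB FG linear_sum big1 // => i _.
by rewrite PsiM Psi_qrel // mulr0.
Qed.

(** Splitting off a root t and expanding in powers of t - 1 turns v into Psi(p(t - 1)) v, until only
    the constant point x(u) = 1 is left. *)
Lemma evS_prod v (s : seq K) : (size s <= n.-1)%N ->
  evS (\prod_(t <- s) (t%:P - 'X)) v = evS 1 (Psi (weight_prod n l s) v).
Proof.
elim: s v => [|t s IH] v ss; first by rewrite /weight_prod !big_nil Psi1.
have sq : (size (\prod_(t <- s) (t%:P - 'X))%R <= n.-1)%N by rewrite size_prod_subX.
rewrite /weight_prod !big_cons -[t in LHS](subrK 1 t) -horner_shift_line shift_lineE horner_sum.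
rewrite mulrC PsiM linME -IH ?(ltnW ss) // ppolyE horner_sum !linear_sum lin_sumE linear_sum.
apply: eq_bigr => i _; have il : (i <= l)%N by rewrite -ltnS.
rewrite Psi_a // hornerZ hornerXn hornerM hornerC hornerXn -rmorphXn /= [in RHS]mulrC mul_mpolyC.
by rewrite linearZ /= linearZ mulrC.
Qed.
End PsiAction.

Lemma bij_of_inj_surj (A B : Type) (f : A -> B) :
  injective f -> (forall y, exists x, f x = y) -> bijective f.
Proof.
move=> f_inj /choice[g gK]; exists g => // x; apply: f_inj; exact: gK.
Qed.

(** * The isomorphism *)

Section Main.
Variables (K : numClosedFieldType) (n l : nat) (z m : 'I_n -> K) (T : holomorphic_rep z m).
Hypothesis n_ge2 : (2 <= n)%N.
Hypothesis sep : separating l m.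
Local Notation S := {mpoly K[l + n]}.
Local Notation E := {linear Sing T l -> Sing T l}.
Local Notation AD := (AD l z m).
Local Notation pi := (@AD_class K n l z m).

Definition tau_fun (g : {linear AD -> K^o}) : Sing T l := MkSing (weight_pairing_sing T n_ge2 g).

Fact tau_linear : linear tau_fun.
Proof.
by move=> a g h; apply: val_inj; rewrite /= weight_pairing_linear // -sing_valP.
Qed.
HB.instance Definition _ :=
  GRing.isLinear.Build K {linear AD -> K^o} (Sing T l) _ tau_fun tau_linear.

Lemma tau_inj : injective tau_fun.
Proof.
move=> g h gh; apply/eqP; rewrite -subr_eq0; apply/eqP/(weight_pairing_inj T n_ge2 sep).
have -> : weight_pairing (g - h) = sing_val (tau_fun (g - h)) by [].
rewrite [tau_fun _]raddfB -[X in sing_val (X - _)]/(tau_fun g) gh subrr.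
exact: (linear0 (\val : Sing T l -> {mpoly K[n]})).
Qed.

Lemma tau_H k g : (1 <= k <= n)%N ->
  tau_fun (mul_dual (pi (hvar K n l k)) g) = H T l k (tau_fun g).
Proof.
case: k => [//|k] kn; apply: val_inj.
by rewrite -[RHS]/(Htilde T k.+1 (weight_pairing g)) Htilde_weight_pairing.
Qed.

Section WithPsi.
Variable Psi : {linear S -> E}.
Hypothesis PsiP : bethe_action Psi.

Let Psi_gen F : Psi F \in subalg_gen (fun f : E => exists2 k, (1 <= k <= n)%N & f = H T l k).
Proof. by case: PsiP. Qed.

Definition psi_fun (x : AD) : bethe_alg T l := Subalg (Psi_gen (repr x)).

Lemma psi_funE F : subalg_val (psi_fun (pi F)) = Psi F.
Proof.
apply: (Psi_factor n_ge2 PsiP); exact: reprK.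
Qed.

Fact psi_zmod : zmod_morphism psi_fun.
Proof.
move=> x y; have [[F ->] [G ->]] := (AD_class_surj x, AD_class_surj y).
apply: val_inj; rewrite -[LHS]/(subalg_val _) -raddfB psi_funE linearB.
by rewrite -(psi_funE F) -(psi_funE G).
Qed.

Fact psi_monoid : monoid_morphism psi_fun.
Proof.
split=> [|x y]; first by apply: val_inj; rewrite -AD_class1 -[LHS]/(subalg_val _) psi_funE; case: PsiP.
have [[F ->] [G ->]] := (AD_class_surj x, AD_class_surj y).
apply: val_inj; rewrite -[LHS]/(subalg_val _) -AD_classM psi_funE.
by case: PsiP => _ -> _ _ _; rewrite -(psi_funE F) -(psi_funE G).
Qed.

HB.instance Definition _ := GRing.isZmodMorphism.Build AD (bethe_alg T l) psi_fun psi_zmod.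
HB.instance Definition _ := GRing.isMonoidMorphism.Build AD (bethe_alg T l) psi_fun psi_monoid.

Lemma psi_is_psi_DW : is_psi_DW psi_fun.
Proof.
split=> [c x|[f fgen]|s sn].
- have [F ->] := AD_class_surj x; apply: val_inj.
  rewrite -[LHS]/(subalg_val _) -linearZ psi_funE linearZ.
  by rewrite -(psi_funE F).
- suff [F PF] : exists F, Psi F = f.
    by exists (pi F); apply: val_inj; rewrite -[LHS]/(subalg_val _) psi_funE.
  case: PsiP => P1 PM _ Ph _.
  (* The image of [Psi] is a unital subalgebra containing the H_k, hence contains the one they
     generate. *)
  move/subalg_genP: fgen => /(_ (fun f : E => `[< exists F, Psi F = f >])) fP.
  apply/asboolP/fP.
  + by apply/asboolP; exists 1.
  + move=> a u v /asboolP[F <-] /asboolP[G <-]; apply/asboolP.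
    by exists (a *: F + G); rewrite linearP.
  + move=> u v /asboolP[F <-] /asboolP[G <-]; apply/asboolP.
    by exists (F * G); rewrite PM.
  + by move=> _ [k kn ->]; apply/asboolP; exists (hvar K n l k); apply: Ph.
- by rewrite psi_funE; case: PsiP => _ _ _ -> .
Qed.

Lemma tau_surj v : exists g, tau_fun g = v.
Proof.
(* Evaluating at this constant instead of 1 contributes [sg] to the power l, which cancels the sign
   in [weight_pairingE]. *)
pose sg : K := (-1) ^+ n.-1.
pose g0 (x : AD) : K^o := evS sg%:P (subalg_val (psi_fun x) v).
have g0pi F : g0 (pi F) = evS sg%:P (Psi F v) by rewrite /g0 psi_funE.
have g0_lin : linear g0.
  move=> c x y; have [[F ->] [G ->]] := (AD_class_surj x, AD_class_surj y).
  by rewrite -AD_classP !g0pi !linearP.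
pose g : {linear AD -> K^o} := HB.pack g0 (GRing.isLinear.Build K AD K^o _ g0 g0_lin).
exists g; apply: val_inj; rewrite -[LHS]/(weight_pairing g) -[RHS]/(sing_val v).
apply/eqP; rewrite -subr_eq0; apply/eqP/ev_eq0 => [|c s ss _]; first exact: ltnW.
rewrite raddfB /= weight_pairingE // (ev_homog _ c (sing_homog v)).
rewrite -/(evS _ v) (evS_prod PsiP) ?ss // -[g (pi _)]/(g0 (pi _)) g0pi.
rewrite /evS -[sg%:P]mulr1 mul_polyC (ev_homog _ sg (sing_homog _)) mulrA -exprMn.
by rewrite mulrAC -expr2 /sg sqrr_sign mul1r subrr.
Qed.
End WithPsi.

Lemma tau_bij : bijective tau_fun.
Proof.
apply: bij_of_inj_surj; first exact: tau_inj.
by have [Psi PsiP] := bethe_action_exists T n_ge2 sep; apply: (tau_surj PsiP).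
Qed.

Lemma tau_intertwines (psi : {rmorphism AD -> bethe_alg T l}) : is_psi_DW psi ->
  forall f g, tau_fun (mul_dual f g) = subalg_val (psi f) (tau_fun g).
Proof.
case=> psiZ _ psi_h f.
pose P (f : AD) := forall g, tau_fun (mul_dual f g) = subalg_val (psi f) (tau_fun g).
apply: (@AD_ind K n l z m n_ge2 P sep) => [g|c x y Px Py g|x y Px Py g|k kn g].
- by rewrite mul_dual1 rmorph1.
- by rewrite mul_dual_lin tau_linear rmorphD psiZ Px Py.
- by rewrite mul_dualM Px Py rmorphM.
- by rewrite tau_H // psi_h.
Qed.

(** If psi(f) = 0, then tau(L_f^* g) = 0, so L_f^* g = 0, and its value at 1 gives g(f) = 0 for
    every functional g. Functionals separate points, so f = 0. *)
Lemma psi_bij (psi : {rmorphism AD -> bethe_alg T l}) : is_psi_DW psi -> bijective psi.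
Proof.
move=> psiP; have tw := tau_intertwines psiP; case: psiP => _ psi_surj _.
apply: bij_of_inj_surj psi_surj; apply: raddf_inj => f f0.
apply/eqP/contraT => /exists_functional[g /negP[]]; apply/eqP.
have /(congr1 (fun h : {linear AD -> K^o} => h 1)) : mul_dual f g = 0.
  apply: tau_inj; rewrite tw f0; apply: val_inj.
  by rewrite -[RHS]/(sing_val (tau_fun 0)) [tau_fun 0]linear0.
by rewrite mul_dualE mulr1.
Qed.

Lemma bethe_isomorphism :
  exists tau : {linear {linear AD -> K^o} -> Sing T l},
    [/\ forall g, sing_val (tau g) = weight_pairing g,
        bijective tau,
        exists psi : {rmorphism AD -> bethe_alg T l}, is_psi_DW psi &
        forall psi : {rmorphism AD -> bethe_alg T l}, is_psi_DW psi ->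
          (forall (f : AD) (g : {linear AD -> K^o}),
              tau (mul_dual f g) = subalg_val (psi f) (tau g))
          /\ bijective psi].
Proof.
exists tau_fun; split=> //; first exact: tau_bij.
  have [Psi PsiP] := bethe_action_exists T n_ge2 sep.
  by exists (psi_fun PsiP); apply: psi_is_psi_DW.
by move=> psi psiP; split; [apply: tau_intertwines | apply: psi_bij].
Qed.
End Main.

Theorem corollary7p3p2 (R : realType) (n l : nat) (z m : 'I_n -> R[i])
    (T : holomorphic_rep z m)
    (n_ge2 : (2 <= n)%N) (sep : separating l m) :
  exists tau : {linear {linear AD l z m -> (R[i])^o} -> Sing T l},
    [/\ forall g, sing_val (tau g) = weight_pairing g,
        bijective tau,
        exists psi : {rmorphism AD l z m -> bethe_alg T l}, is_psi_DW psi &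
        forall psi : {rmorphism AD l z m -> bethe_alg T l}, is_psi_DW psi ->
          (forall (f : AD l z m) (g : {linear AD l z m -> (R[i])^o}),
              tau (mul_dual f g) = subalg_val (psi f) (tau g))
          /\ bijective psi].
Proof. exact: (@bethe_isomorphism R[i]). Qed.
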